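(* Let $(\mathcal B,\mathbb E,\mathfrak s)$ be an extriangulated category, let $(\mathcal U,\mathcal V)$ and $(\mathcal U',\mathcal V')$ be arbitrary cotorsion pairs on $\mathcal B$ with hearts $\underline{\mathcal H},\underline{\mathcal H}'$ and associated functors $H\colon\mathcal B\to\underline{\mathcal H}$, $H'\colon\mathcal B\to\underline{\mathcal H}'$, and let $\mathcal K$ and $\mathcal K'$ be their kernels, respectively. The following are equivalent. (1) $(\mathcal U,\mathcal V)$ and $(\mathcal U',\mathcal V')$ are heart-equivalent. (2) $H'(\mathcal U)=H'(\mathcal V)=0$ and $H(\mathcal U')=H(\mathcal V')=0$. (3) $\mathcal K=\mathcal K'$.
   Context: Extriangulated category $(\mathcal B,\mathbb E,\mathfrak s)$: (ET1) $\mathcal B$ is an additive category and $\mathbb E\colon\mathcal B^{\mathrm{op}}\times\mathcal B\to \mathrm{Ab}$ is an additive bifunctor; for $\delta\in\mathbb E(C,A)$, $a\colon A\to A'$, $c\colon C'\to C$ write $a_*\delta=\mathbb E(C,a)(\delta)$ and $c^*\delta=\mathbb E(c,A)(\delta)$. Sequences $A\to B\to C$ and $A\to B'\to C$ are equivalent if there is an isomorphism $B\cong B'$ compatible with the identities of $A$ and $C$. $\mathfrak s$ assigns to each $\delta\in\mathbb E(C,A)$ an equivalence class $\mathfrak s(\delta)=[A\xrightarrow{x}B\xrightarrow{y}C]$; we say $A\xrightarrow{x}B\xrightarrow{y}C$ realizes $\delta$. (ET2) $\mathfrak s$ is an additive realization: if $A\xrightarrow{x}B\xrightarrow{y}C$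 realizes $\delta$, $A'\xrightarrow{x'}B'\xrightarrow{y'}C'$ realizes $\delta'$ and $a\colon A\to A'$, $c\colon C\to C'$ satisfy $a_*\delta=c^*\delta'$, then there is $b\colon B\to B'$ with $bx=x'a$, $y'b=cy$; $0\in\mathbb E(C,A)$ is realized by the split sequence $A\to A\oplus C\to C$; and $\mathfrak s(\delta\oplus\delta')=\mathfrak s(\delta)\oplus\mathfrak s(\delta')$. (ET3) If $A\xrightarrow{x}B\xrightarrow{y}C$ realizes $\delta\in\mathbb E(C,A)$, $A'\xrightarrow{x'}B'\xrightarrow{y'}C'$ realizes $\delta'\in\mathbb E(C',A')$ and $a\colon A\to A'$, $b\colon B\to B'$ satisfy $bx=x'a$, then there is $c\colon C\to C'$ with $cy=y'b$ and $a_*\delta=c^*\delta'$; and (ET3)$^{\mathrm{op}}$, its dual. (ET4) If $\delta\in\mathbb E(D,A)$ and $\delta'\in\mathbb E(F,B)$ are realized by $A\xrightarrow{f}B\xrightarrow{f'}D$ and $B\xrightarrow{g}C\xrightarrow{g'}F$, there are an object $E$, morphisms $d\colon D\to E$, $e\colon E\to F$, $h'\colon C\to E$ with $h'g=df'$, $eh'=g'$, and $\delta''\in\mathbb E(E,A)$ realized by $A\xrightarrow{gf}C\xrightarrow{h'}E$, such that $D\xrightarrow{d}E\xrightarrow{e}F$ realizes $f'_*\delta'$, $d^*\delta''=\delta$ and $f_*\delta''=e^*\delta'$; and (ET4)$^{\mathrm{op}}$, its dual. A conflation $A\rightarrowtail B\twoheadrightarrow C$ is a sequence realizing some $\delta\in\mathbb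 E(C,A)$. For full subcategories $\mathcal X,\mathcal Y\subseteq\mathcal B$: $\mathrm{Cone}(\mathcal X,\mathcal Y)$ is the full subcategory of objects $B$ admitting a conflation $X\rightarrowtail Y\twoheadrightarrow B$, and $\mathrm{CoCone}(\mathcal X,\mathcal Y)$ that of objects $B$ admitting a conflation $B\rightarrowtail X\twoheadrightarrow Y$, and $\mathcal X\ast\mathcal Y$ that of objects $B$ admitting a conflation $X\rightarrowtail B\twoheadrightarrow Y$, with $X\in\mathcal X$, $Y\in\mathcal Y$. A cotorsion pair $(\mathcal U,\mathcal V)$ on $\mathcal B$ is a pair of full additive subcategories closed under direct summands and isomorphisms with $\mathbb E(\mathcal U,\mathcal V)=0$ and such that every $B\in\mathcal B$ admits conflations $V_B\rightarrowtail U_B\twoheadrightarrow B$ and $B\rightarrowtail V^B\twoheadrightarrow U^B$ with $U_B,U^B\in\mathcal U$, $V_B,V^B\in\mathcal V$. Put $\mathcal W=\mathcal U\cap\mathcal V$, $\mathcal B^+=\mathrm{Cone}(\mathcal V,\mathcal W)$, $\mathcal B^-=\mathrm{CoCone}(\mathcal W,\mathcal U)$, $\mathcal H=\mathcal B^+\cap\mathcal B^-$, $\underline{\mathcal B}=\mathcal B/\mathcal W$ (ideal quotient by morphisms factoring through $\mathcal W$; $\underline f$ is the image of $f$), $\underline{\mathcal B}^{\pm}=\mathcal B^{\pm}/\mathcal W$. The heart is $\underline{\mathcal H}=\mathcal H/\mathcal W$, which is an abelian category. A reflection sequence for $B$ is a conflation $B\overset{z}{\rightarrowtail}Z\twoheadrightarrow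 U$ with $Z\in\mathcal B^+$, $U\in\mathcal U$ such that $z^*\colon\mathbb E(Z,V)\to\mathbb E(B,V)$ is surjective for all $V\in\mathcal V$. A coreflection sequence for $B$ is a conflation $V\rightarrowtail X\overset{x}{\twoheadrightarrow}B$ with $X\in\mathcal B^-$, $V\in\mathcal V$ such that $x_*\colon\mathbb E(U,X)\to\mathbb E(U,B)$ is surjective for all $U\in\mathcal U$. Every object has both. For each $B$ choose a reflection sequence $B\overset{p_B}{\rightarrowtail}B^+\twoheadrightarrow U$ and a coreflection sequence $V\rightarrowtail B^-\overset{m_B}{\twoheadrightarrow}B$ (with $B^{\pm}=B$ and identity map if $B\in\mathcal B^{\pm}$). The functor $\sigma^+\colon\underline{\mathcal B}\to\underline{\mathcal B}^+$ is $B\mapsto B^+$, with $\sigma^+(\underline f)$ for $f\colon B\to C$ the unique morphism satisfying $\sigma^+(\underline f)\,\underline{p_B}=\underline{p_C}\,\underline f$; dually $\sigma^-\colon\underline{\mathcal B}\to\underline{\mathcal B}^-$ is $B\mapsto B^-$, with $\underline{m_C}\,\sigma^-(\underline f)=\underline f\,\underline{m_B}$. With $\pi\colon\mathcal B\to\underline{\mathcal B}$ the quotient functor, the associated functor is $H=\sigma^-\circ\sigma^+\circ\pi\colon\mathcal B\to\underline{\mathcal H}$. The functor $H'$ and heart $\underline{\mathcal H}'$ are the same constructions for $(\mathcal U',\mathcal V')$. The kernel of $(\mathcal U,\mathcal V)$ is $\mathcal K=\mathrm{add}(\mathcal U\ast\mathcal V)$, where $\mathrm{add}$ denotes closure under direct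 summands in $\mathcal B$. Two cotorsion pairs $(\mathcal U,\mathcal V)$ and $(\mathcal U',\mathcal V')$ (not required to form a twin cotorsion pair) are heart-equivalent if there is an equivalence of categories $E\colon\underline{\mathcal H}\to\underline{\mathcal H}'$ with $E\circ H\cong H'$ (natural isomorphism). For a subcategory $\mathcal X$, $H(\mathcal X)=0$ means $H(X)\cong0$ for all $X\in\mathcal X$. *)

(* Defs.v *)
From HB Require Import structures.
From mathcomp Require Import all_boot all_order all_algebra.
From mathcomp Require Import boolp.

Set Implicit Arguments.
Unset Strict Implicit.
Unset Printing Implicit Defensive.

Import GRing.Theory.
Import Quotient.
Local Open Scope ring_scope.
Local Open Scope quotient_scope.

Record preadditive := Preadditive {
  obj :> Type;
  hom : obj -> obj -> zmodType;
  idm : forall A, hom A A;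
  comp : forall A B C, hom B C -> hom A B -> hom A C;
  comp1m : forall A B (f : hom A B), comp (idm B) f = f;
  compm1 : forall A B (f : hom A B), comp f (idm A) = f;
  compA : forall A B C D (h : hom C D) (g : hom B C) (f : hom A B),
    comp h (comp g f) = comp (comp h g) f;
  compDl : forall A B C (g g' : hom B C) (f : hom A B),
    comp (g + g') f = comp g f + comp g' f;
  compDr : forall A B C (g : hom B C) (f f' : hom A B),
    comp g (f + f') = comp g f + comp g f' }.

Declare Scope cat_scope.
Delimit Scope cat_scope with cat.
Notation "g \oc f" := (comp g f) (at level 40, left associativity) : cat_scope.
Open Scope cat_scope.

Section Categories.
Variable C : preadditive.
Implicit Types A B D X Z : C.

Definition is_iso (A B : C) (f : hom A B) :=
  exists g : hom B A, g \oc f = idm A /\ f \oc g = idm B.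

Definition isomorphic (A B : C) := exists f : hom A B, is_iso f.

Definition zero_object (Z : C) :=
  forall A : C, (exists! f : hom Z A, True) /\ (exists! f : hom A Z, True).

Record biproduct (A B : C) := Biproduct {
  bip :> C;
  bin1 : hom A bip;
  bin2 : hom B bip;
  bpr1 : hom bip A;
  bpr2 : hom bip B;
  bpr1in1 : bpr1 \oc bin1 = idm A;
  bpr2in2 : bpr2 \oc bin2 = idm B;
  bpr1in2 : bpr1 \oc bin2 = 0;
  bpr2in1 : bpr2 \oc bin1 = 0;
  binpr : bin1 \oc bpr1 + bin2 \oc bpr2 = idm bip }.

Definition summand (A X : C) := exists A' (S : biproduct A A'), isomorphic S X.

Lemma comp0l A B D (f : hom A B) : (0 : hom B D) \oc f = 0.
Proof. by apply: (@addrI _ (0 \oc f)); rewrite -compDl !addr0. Qed.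

Lemma comp0r A B D (g : hom B D) : g \oc (0 : hom A B) = 0.
Proof. by apply: (@addrI _ (g \oc 0)); rewrite -compDr !addr0. Qed.

Lemma compNl A B D (g : hom B D) (f : hom A B) : (- g) \oc f = - (g \oc f).
Proof. by apply: (@addrI _ (g \oc f)); rewrite -compDl !subrr comp0l. Qed.

Lemma compNr A B D (g : hom B D) (f : hom A B) : g \oc (- f) = - (g \oc f).
Proof. by apply: (@addrI _ (g \oc f)); rewrite -compDr !subrr comp0r. Qed.

Lemma compBl A B D (g g' : hom B D) (f : hom A B) :
  (g - g') \oc f = g \oc f - g' \oc f.
Proof. by rewrite compDl compNl. Qed.

Lemma compBr A B D (g : hom B D) (f f' : hom A B) :
  g \oc (f - f') = g \oc f - g \oc f'.
Proof. by rewrite compDr compNr. Qed.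

Lemma zero_objectP (Z : C) : zero_object Z <-> idm Z = 0.
Proof.
split=> [/(_ Z) [[f [_ uf]] _]|Z0 A]; first by rewrite -(uf (idm Z)) ?(uf 0).
split; exists 0; split=> // f _.
  by rewrite -(compm1 f) Z0 comp0r.
by rewrite -(comp1m f) Z0 comp0l.
Qed.

End Categories.

(* The homs of a full subcategory are those of the ambient category. *)
Definition full_sub (C : preadditive) (P : C -> Prop) : preadditive :=
  @Preadditive {A : C | P A} (fun A B => hom (sval A) (sval B))
    (fun A => idm (sval A)) (fun A B D g f => g \oc f)
    (fun A B f => comp1m f) (fun A B f => compm1 f)
    (fun A B D F h g f => compA h g f)
    (fun A B D g g' f => compDl g g' f) (fun A B D g f f' => compDr g f f').


(* No additivity is required: functors and equivalences are those of the
   underlying categories. *)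
Record functor (C D : preadditive) := Functor {
  fobj :> C -> D;
  fmap : forall A B, hom A B -> hom (fobj A) (fobj B);
  fmap1 : forall A, fmap (idm A) = idm (fobj A);
  fmapM : forall A B E (g : hom B E) (f : hom A B),
    fmap (g \oc f) = fmap g \oc fmap f }.

Definition functor_id (C : preadditive) : functor C C :=
  @Functor C C (fun A => A) (fun A B f => f) (fun=> erefl)
    (fun A B E g f => erefl).

Section FunctorComp.
Variables C D F : preadditive.

Lemma functor_comp_fmap1 (G : functor D F) (H : functor C D) (A : C) :
  fmap G (fmap H (idm A)) = idm (G (H A)).
Proof. by rewrite !fmap1. Qed.

Lemma functor_comp_fmapM (G : functor D F) (H : functor C D)
    (A B E : C) (g : hom B E) (f : hom A B) :
  fmap G (fmap H (g \oc f)) = fmap G (fmap H g) \oc fmap G (fmap H f).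
Proof. by rewrite !fmapM. Qed.

Definition functor_comp (G : functor D F) (H : functor C D) : functor C F :=
  @Functor C F (fun A => G (H A)) (fun A B f => fmap G (fmap H f))
    (functor_comp_fmap1 G H) (functor_comp_fmapM G H).

End FunctorComp.

Definition full_incl (C : preadditive) (P : C -> Prop) :
    functor (full_sub P) C :=
  @Functor (full_sub P) C (fun A => sval A) (fun A B f => f) (fun=> erefl)
    (fun A B E g f => erefl).

Definition corestrict (C D : preadditive) (P : D -> Prop) (F : functor C D)
    (FP : forall A, P (F A)) : functor C (full_sub P) :=
  @Functor C (full_sub P) (fun A => exist P (F A) (FP A))
    (fun A B f => fmap F f) (fun A => fmap1 F A)
    (fun A B E g f => fmapM F g f).

Definition nat_iso (C D : preadditive) (F G : functor C D) :=
  exists a : forall A, hom (F A) (G A), (forall A, is_iso (a A)) /\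
    forall A B (f : hom A B), a B \oc fmap F f = fmap G f \oc a A.

Definition is_equivalence (C D : preadditive) (F : functor C D) :=
  exists G : functor D C,
    nat_iso (functor_comp G F) (functor_id C) /\
    nat_iso (functor_comp F G) (functor_id D).

Record additive := Additive {
  apre :> preadditive;
  azero : apre;
  azeroP : zero_object azero;
  asum : forall A B : apre, biproduct A B }.

Record additive_sub (B : additive) := AdditiveSub {
  mem_sub :> B -> Prop;
  mem_sub0 : mem_sub (azero B);
  mem_subD : forall A A', mem_sub A -> mem_sub A' -> mem_sub (asum A A') }.

Section IdealQuotient.
Variables (B : additive) (W : additive_sub B).

Definition factors (A C : B) (f : hom A C) :=
  exists X, W X /\ exists (g : hom A X) (h : hom X C), f = h \oc g.

Definition ideal (A C : B) : {pred hom A C} := fun f => `[< factors f >].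
Arguments ideal : clear implicits.

Lemma idealP A C (f : hom A C) : reflect (factors f) (f \in ideal A C).
Proof. exact: asboolP. Qed.

Lemma ideal_closed A C : zmod_closed (ideal A C).
Proof.
split=> [|f f' /idealP[X [WX [g [h ->]]]] /idealP[X' [WX' [g' [h' ->]]]]].
  apply/idealP; exists (azero B); split; first exact: mem_sub0.
  by exists 0, 0; rewrite comp0l.
apply/idealP; exists (asum X X'); split; first exact: mem_subD.
set S := asum X X'.
exists (bin1 S \oc g + bin2 S \oc g'), (h \oc bpr1 S - h' \oc bpr2 S).
rewrite compBl !compDr -!compA !(compA (bpr1 S)) !(compA (bpr2 S)).
by rewrite bpr1in1 bpr1in2 bpr2in1 bpr2in2 !comp1m !comp0l !comp0r addr0 add0r.
Qed.

HB.instance Definition _ A C :=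
  GRing.isZmodClosed.Build (hom A C) (ideal A C) (ideal_closed A C).

Lemma ideal_compl A C D (g : hom C D) (f : hom A C) :
  f \in ideal A C -> g \oc f \in ideal A D.
Proof.
move=> /idealP[X [WX [u [v ->]]]]; apply/idealP.
by exists X; split=> //; exists u, (g \oc v); rewrite compA.
Qed.

Lemma ideal_compr A C D (g : hom C D) (f : hom A C) :
  g \in ideal C D -> g \oc f \in ideal A D.
Proof.
move=> /idealP[X [WX [u [v ->]]]]; apply/idealP.
by exists X; split=> //; exists (u \oc f), v; rewrite compA.
Qed.

Definition qhom (A C : B) : zmodType := {quot (ideal A C)}.

Definition qpi (A C : B) (f : hom A C) : qhom A C := \pi_({quot (ideal A C)}) f.

Definition qcomp (A C D : B) (g : qhom C D) (f : qhom A C) : qhom A D :=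
  qpi (repr g \oc repr f).

Lemma qpiP A C (f f' : hom A C) : qpi f = qpi f' <-> f - f' \in ideal A C.
Proof. by rewrite idealrBE; split=> [/eqP|/eqP]. Qed.

Lemma qpi_surj A C (q : qhom A C) : exists f, q = qpi f.
Proof. by exists (repr q); rewrite /qpi reprK. Qed.

Lemma qpiD A C (f f' : hom A C) : qpi (f + f') = qpi f + qpi f'.
Proof. exact: raddfD. Qed.

Lemma qpi_comp A C D (g : hom C D) (f : hom A C) :
  qcomp (qpi g) (qpi f) = qpi (g \oc f).
Proof.
apply/qpiP; set g' := repr _; set f' := repr _.
have g'E : g' - g \in ideal C D by apply/qpiP; rewrite /qpi reprK.
have f'E : f' - f \in ideal A C by apply/qpiP; rewrite /qpi reprK.
have -> : g' \oc f' - g \oc f = (g' - g) \oc f' + g \oc (f' - f).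
  by rewrite compBl compBr addrA subrK.
by apply: rpredD; [exact: ideal_compr | exact: ideal_compl].
Qed.

Lemma qcomp1m A C (f : qhom A C) : qcomp (qpi (idm C)) f = f.
Proof. by have [g ->] := qpi_surj f; rewrite qpi_comp comp1m. Qed.

Lemma qcompm1 A C (f : qhom A C) : qcomp f (qpi (idm A)) = f.
Proof. by have [g ->] := qpi_surj f; rewrite qpi_comp compm1. Qed.

Lemma qcompA A C D E (h : qhom D E) (g : qhom C D) (f : qhom A C) :
  qcomp h (qcomp g f) = qcomp (qcomp h g) f.
Proof.
have [h' ->] := qpi_surj h; have [g' ->] := qpi_surj g.
by have [f' ->] := qpi_surj f; rewrite !qpi_comp compA.
Qed.

Lemma qcompDl A C D (g g' : qhom C D) (f : qhom A C) :
  qcomp (g + g') f = qcomp g f + qcomp g' f.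
Proof.
have [h ->] := qpi_surj g; have [h' ->] := qpi_surj g'.
by have [k ->] := qpi_surj f; rewrite -qpiD !qpi_comp -qpiD compDl.
Qed.

Lemma qcompDr A C D (g : qhom C D) (f f' : qhom A C) :
  qcomp g (f + f') = qcomp g f + qcomp g f'.
Proof.
have [h ->] := qpi_surj f; have [h' ->] := qpi_surj f'.
by have [k ->] := qpi_surj g; rewrite -qpiD !qpi_comp -qpiD compDr.
Qed.

Definition quot_cat : preadditive :=
  @Preadditive B qhom (fun A => qpi (idm A)) qcomp
    qcomp1m qcompm1 qcompA qcompDl qcompDr.

Definition quot_functor : functor B quot_cat :=
  @Functor B quot_cat (fun A => A) qpi (fun=> erefl)
    (fun A C D g f => esym (qpi_comp g f)).

End IdealQuotient.

(* [ext C A] is E(C, A); [push a d] is a_* d and [pull c d] is c^* d. *)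
Record ext_bifunctor (B : preadditive) := ExtBifunctor {
  ext :> B -> B -> zmodType;
  push : forall C A A', hom A A' -> ext C A -> ext C A';
  pull : forall C C' A, hom C' C -> ext C A -> ext C' A;
  push1 : forall C A (d : ext C A), push (idm A) d = d;
  pull1 : forall C A (d : ext C A), pull (idm C) d = d;
  pushM : forall C A A' A'' (a' : hom A' A'') (a : hom A A') (d : ext C A),
    push (a' \oc a) d = push a' (push a d);
  pullM : forall C C' C'' A (c : hom C' C) (c' : hom C'' C') (d : ext C A),
    pull (c \oc c') d = pull c' (pull c d);
  push_pull : forall C C' A A' (a : hom A A') (c : hom C' C) (d : ext C A),
    push a (pull c d) = pull c (push a d);
  pushD : forall C A A' (a : hom A A') (d d' : ext C A),
    push a (d + d') = push a d + push a d';
  pullD : forall C C' A (c : hom C' C) (d d' : ext C A),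
    pull c (d + d') = pull c d + pull c d';
  pushDm : forall C A A' (a a' : hom A A') (d : ext C A),
    push (a + a') d = push a d + push a' d;
  pullDm : forall C C' A (c c' : hom C' C) (d : ext C A),
    pull (c + c') d = pull c d + pull c' d }.

Definition seq_equiv (B : preadditive) (A C M M' : B)
    (x : hom A M) (y : hom M C) (x' : hom A M') (y' : hom M' C) :=
  exists b : hom M M', is_iso b /\ b \oc x = x' /\ y' \oc b = y.

Definition sum_hom (B : additive) (A A' C C' : B) (f : hom A C)
    (f' : hom A' C') : hom (asum A A') (asum C C') :=
  bin1 (asum C C') \oc f \oc bpr1 (asum A A') +
  bin2 (asum C C') \oc f' \oc bpr2 (asum A A').

Definition sum_ext (B : additive) (E : ext_bifunctor B) (A A' C C' : B)
    (d : E C A) (d' : E C' A') : E (asum C C') (asum A A') :=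
  push (bin1 (asum A A')) (pull (bpr1 (asum C C')) d) +
  push (bin2 (asum A A')) (pull (bpr2 (asum C C')) d').

(* [realizes d x y] says that the sequence (x, y) belongs to s(d); by
   [realizes_ex] and [realizes_class] these sequences form one equivalence
   class. *)
Record extriangulated := Extriangulated {
  etB :> additive;
  E_ : ext_bifunctor etB;
  realizes : forall A C : etB, E_ C A ->
    forall M, hom A M -> hom M C -> Prop;
  realizes_ex : forall A C (d : E_ C A),
    exists M (x : hom A M) (y : hom M C), realizes d x y;
  realizes_class : forall A C (d : E_ C A)
      M (x : hom A M) (y : hom M C) M' (x' : hom A M') (y' : hom M' C),
    realizes d x y -> (realizes d x' y' <-> seq_equiv x y x' y');
  ET2_morphism : forall A C (d : E_ C A) M (x : hom A M) (y : hom M C)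
      A' C' (d' : E_ C' A') M' (x' : hom A' M') (y' : hom M' C')
      (a : hom A A') (c : hom C C'),
    realizes d x y -> realizes d' x' y' -> push a d = pull c d' ->
    exists b : hom M M', b \oc x = x' \oc a /\ y' \oc b = c \oc y;
  ET2_split : forall A C,
    realizes (0 : E_ C A) (bin1 (asum A C)) (bpr2 (asum A C));
  ET2_sum : forall A C (d : E_ C A) M (x : hom A M) (y : hom M C)
      A' C' (d' : E_ C' A') M' (x' : hom A' M') (y' : hom M' C'),
    realizes d x y -> realizes d' x' y' ->
    realizes (sum_ext d d') (sum_hom x x') (sum_hom y y');
  ET3 : forall A C (d : E_ C A) M (x : hom A M) (y : hom M C)
      A' C' (d' : E_ C' A') M' (x' : hom A' M') (y' : hom M' C')
      (a : hom A A') (b : hom M M'),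
    realizes d x y -> realizes d' x' y' -> b \oc x = x' \oc a ->
    exists c : hom C C', c \oc y = y' \oc b /\ push a d = pull c d';
  ET3op : forall A C (d : E_ C A) M (x : hom A M) (y : hom M C)
      A' C' (d' : E_ C' A') M' (x' : hom A' M') (y' : hom M' C')
      (b : hom M M') (c : hom C C'),
    realizes d x y -> realizes d' x' y' -> y' \oc b = c \oc y ->
    exists a : hom A A', x' \oc a = b \oc x /\ push a d = pull c d';
  ET4 : forall A B C D F (d0 : E_ D A) (d1 : E_ F B)
      (f : hom A B) (f' : hom B D) (g : hom B C) (g' : hom C F),
    realizes d0 f f' -> realizes d1 g g' ->
    exists E (d : hom D E) (e : hom E F) (h' : hom C E) (d2 : E_ E A),
      [/\ h' \oc g = d \oc f' /\ e \oc h' = g',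
          realizes d2 (g \oc f) h',
          realizes (push f' d1) d e,
          pull d d2 = d0 &
          push f d2 = pull e d1];
  ET4op : forall A B C D F (d0 : E_ B D) (d1 : E_ C F)
      (f' : hom D A) (f : hom A B) (g' : hom F B) (g : hom B C),
    realizes d0 f' f -> realizes d1 g' g ->
    exists E (d : hom D E) (e : hom E F) (h' : hom E A) (d2 : E_ C E),
      [/\ f \oc h' = g' \oc e /\ h' \oc d = f',
          realizes d2 h' (g \oc f),
          realizes (pull g' d0) d e,
          push e d2 = d1 &
          push d d0 = pull g d2] }.

Section Subcategories.
Variable B : extriangulated.
Implicit Types X Y : B -> Prop.

Definition conflation (A M C : B) (x : hom A M) (y : hom M C) :=
  exists d : E_ B C A, realizes d x y.

Definition cone X Y : B -> Prop := fun C =>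
  exists A M (x : hom A M) (y : hom M C), [/\ X A, Y M & conflation x y].

Definition cocone X Y : B -> Prop := fun A =>
  exists M C (x : hom A M) (y : hom M C), [/\ X M, Y C & conflation x y].

Definition extension X Y : B -> Prop := fun M =>
  exists A C (x : hom A M) (y : hom M C), [/\ X A, Y C & conflation x y].

Definition add_closure X : B -> Prop := fun A => exists2 M, X M & summand A M.

End Subcategories.

Record cotorsion_pair (B : extriangulated) := CotorsionPair {
  cotU : additive_sub B;
  cotV : additive_sub B;
  cotU_summand : forall A X : B, cotU X -> summand A X -> cotU A;
  cotV_summand : forall A X : B, cotV X -> summand A X -> cotV A;
  cotU_iso : forall A X : B, cotU X -> isomorphic X A -> cotU A;
  cotV_iso : forall A X : B, cotV X -> isomorphic X A -> cotV A;
  cot_ext0 : forall U V (d : E_ B U V), cotU U -> cotV V -> d = 0;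
  cot_left : forall A : B, exists V U (x : hom V U) (y : hom U A),
    [/\ cotV V, cotU U & conflation x y];
  cot_right : forall A : B, exists V U (x : hom A V) (y : hom V U),
    [/\ cotV V, cotU U & conflation x y] }.

Section Exactness.
Variable B : extriangulated.
Implicit Types A C M X : B.
Local Notation E := (E_ B).

Lemma push0 C A A' (a : hom A A') : push a (0 : E C A) = 0.
Proof. by apply: (@addrI _ (push a 0)); rewrite -pushD !addr0. Qed.

Lemma pull0 C C' A (c : hom C' C) : pull c (0 : E C A) = 0.
Proof. by apply: (@addrI _ (pull c 0)); rewrite -pullD !addr0. Qed.

Lemma pullBm C C' A (c c' : hom C' C) (d : E C A) :
  pull (c - c') d = pull c d - pull c' d.
Proof. by apply: (addIr (pull c' d)); rewrite -pullDm !subrK. Qed.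

Lemma pushBm C A A' (a a' : hom A A') (d : E C A) :
  push (a - a') d = push a d - push a' d.
Proof. by apply: (addIr (push a' d)); rewrite -pushDm !subrK. Qed.

Lemma extend_along A C M (d : E C A) (x : hom A M) (y : hom M C)
    X (a : hom A X) :
  realizes d x y -> push a d = 0 -> exists a' : hom M X, a = a' \oc x.
Proof.
move=> dxy ad0; have sp := @ET2_split B X C.
have [|b [bx _]] := ET2_morphism (a := a) (c := idm C) dxy sp.
  by rewrite ad0 pull1.
by exists (bpr1 (asum X C) \oc b); rewrite -compA bx compA bpr1in1 comp1m.
Qed.

Lemma lift_along A C M (d : E C A) (x : hom A M) (y : hom M C)
    X (c : hom X C) :
  realizes d x y -> pull c d = 0 -> exists c' : hom X M, c = y \oc c'.
Proof.
move=> dxy cd0; have sp := @ET2_split B A X.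
have [|b [_ yb]] := ET2_morphism (a := idm A) (c := c) sp dxy.
  by rewrite cd0 push1.
by exists (b \oc bin2 (asum A X)); rewrite compA yb -compA bpr2in2 compm1.
Qed.

Lemma hom_exactl A C M (d : E C A) (x : hom A M) (y : hom M C)
    X (g : hom M X) :
  realizes d x y -> g \oc x = 0 -> exists c : hom C X, g = c \oc y.
Proof.
move=> dxy gx0; have sp := @ET2_split B (azero B) X.
set S := asum (azero B) X in sp.
have [|c [cy _]] := ET3 (a := 0) (b := bin2 S \oc g) dxy sp.
  by rewrite -compA gx0 !comp0r.
by exists c; rewrite cy compA bpr2in2 comp1m.
Qed.

Lemma hom_exactr A C M (d : E C A) (x : hom A M) (y : hom M C)
    X (g : hom X M) :
  realizes d x y -> y \oc g = 0 -> exists a : hom X A, g = x \oc a.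
Proof.
move=> dxy yg0; have sp := @ET2_split B X (azero B).
set S := asum X (azero B) in sp.
have [|a [xa _]] := ET3op (b := g \oc bpr1 S) (c := 0) sp dxy.
  by rewrite compA yg0 !comp0l.
by exists a; rewrite xa -compA bpr1in1 compm1.
Qed.

Lemma ext_exact_push A C M (d : E C A) (x : hom A M) (y : hom M C)
    X (b : E X M) :
  realizes d x y -> push y b = 0 -> exists a : E X A, b = push x a.
Proof.
move=> dxy yb0; have [N [g [g' bg]]] := realizes_ex b.
have [F [u [e [h' [d2 [_ _ ue _ xd2]]]]]] := ET4 dxy bg.
rewrite yb0 in ue.
have [|s es] := lift_along (c := idm X) ue; first by rewrite pull0.
by exists (pull s d2); rewrite push_pull xd2 -pullM -es pull1.
Qed.

Lemma ext_exact_pull A C M (d : E C A) (x : hom A M) (y : hom M C)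
    X (b : E M X) :
  realizes d x y -> pull x b = 0 -> exists c : E C X, b = pull y c.
Proof.
move=> dxy xb0; have [N [g' [g bg]]] := realizes_ex b.
have [F [u [e [h' [d2 [_ _ ue _ yd2]]]]]] := ET4op bg dxy.
rewrite xb0 in ue.
have [|s es] := extend_along (a := idm X) ue; first by rewrite push0.
by exists (push s d2); rewrite -push_pull -yd2 -pushM -es push1.
Qed.

End Exactness.

Section Heart.
Variables (B : extriangulated) (UV : cotorsion_pair B).
Local Notation E := (E_ B).
Local Notation U := (cotU UV).
Local Notation V := (cotV UV).

Definition cotW : additive_sub B :=
  @AdditiveSub B (fun A => U A /\ V A) (conj (mem_sub0 U) (mem_sub0 V))
    (fun A A' WA WA' =>
       conj (mem_subD (proj1 WA) (proj1 WA')) (mem_subD (proj2 WA) (proj2 WA'))).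

Definition Bplus : B -> Prop := cone V cotW.
Definition Bminus : B -> Prop := cocone cotW U.
Definition inH (A : B) := Bplus A /\ Bminus A.

(* W is contained in B^+, B^- and H, so the quotients B^+/W, B^-/W and H/W are
   the full subcategories of B/W on the same objects. *)
Definition BmodW : preadditive := quot_cat cotW.
Definition BplusW : preadditive := full_sub (C := BmodW) Bplus.
Definition BminusW : preadditive := full_sub (C := BmodW) Bminus.
Definition heart : preadditive := full_sub (C := BmodW) inH.

Definition kernel : B -> Prop := add_closure (extension U V).

Record reflection_seq (A : B) := ReflectionSeq {
  rZ : B;
  rz : hom A rZ;
  rU : B;
  ru : hom rZ rU;
  r_conflation : conflation rz ru;
  rZ_plus : Bplus rZ;
  rU_U : U rU;
  r_surj : forall X, V X -> forall d : E A X, exists d' : E rZ X,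
    pull rz d' = d }.

Record coreflection_seq (A : B) := CoreflectionSeq {
  cX : B;
  cx : hom cX A;
  cV : B;
  cv : hom cV cX;
  c_conflation : conflation cv cx;
  cX_minus : Bminus cX;
  cV_V : V cV;
  c_surj : forall X, U X -> forall d : E X A, exists d' : E X cX,
    push cx d' = d }.

(* [refl_id] says that the chosen A -> A^+ is the identity of A when A is in
   B^+; as A^+ = A is an equality of objects, it is stated on dependent pairs. *)
Record reflection_choice := ReflectionChoice {
  refl :> forall A : B, reflection_seq A;
  refl_id : forall A : B, Bplus A ->
    existT (fun Z : B => hom A Z : Type) (rZ (refl A)) (rz (refl A)) =
    existT (fun Z : B => hom A Z : Type) A (idm A) }.

Record coreflection_choice := CoreflectionChoice {
  corefl :> forall A : B, coreflection_seq A;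
  corefl_id : forall A : B, Bminus A ->
    existT (fun X : B => hom X A : Type) (cX (corefl A)) (cx (corefl A)) =
    existT (fun X : B => hom X A : Type) A (idm A) }.

Lemma reflection_ex A A' (r : reflection_seq A) (r' : reflection_seq A')
    (q : hom (p := BmodW) A A') :
  exists s : hom (p := BmodW) (rZ r) (rZ r'),
    s \oc (qpi cotW (rz r) : hom (p := BmodW) A (rZ r)) =
    (qpi cotW (rz r') : hom (p := BmodW) A' (rZ r')) \oc q.
Proof.
have [f ->] := qpi_surj q.
have [V0 [W0 [x [w [V0V [W0U W0V] [eta xw]]]]]] := rZ_plus r'.
pose f' := rz r' \oc f.
have [th thE] := r_surj r V0V (pull f' eta).
have [M [k1 [k2 kth]]] := realizes_ex th.
have [rho rhoP] := r_conflation r.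
have [K [d [e [h' [d2 [[k2h' h'd] h'P de _ _]]]]]] := ET4op kth rhoP.
rewrite thE in de.
have [|k [kd wk]] := ET2_morphism (a := idm V0) (c := f') de xw.
  by rewrite push1.
have [k' k'E] := extend_along (a := k) h'P (cot_ext0 _ (rU_U r) W0V).
have k'k1 : k' \oc k1 = x \oc idm V0 by rewrite -kd k'E -compA h'd.
have [g [gk2 gth]] := ET3 kth xw k'k1.
have [|c cE] := lift_along (c := g \oc rz r - f') xw.
  by rewrite pullBm pullM -gth push1 thE subrr.
exists (qpi cotW g); rewrite /= !qpi_comp; apply/qpiP.
by apply/idealP; exists W0; split; [split|exists c, w].
Qed.

Lemma reflection_uniq A A' (r : reflection_seq A) (r' : reflection_seq A')
    (s s' : hom (p := BmodW) (rZ r) (rZ r')) :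
  s \oc (qpi cotW (rz r) : hom (p := BmodW) A (rZ r)) =
  s' \oc (qpi cotW (rz r) : hom (p := BmodW) A (rZ r)) -> s = s'.
Proof.
have [g ->] := qpi_surj s; have [g' ->] := qpi_surj s' => {s s'}.
rewrite /= !qpi_comp => /qpiP; rewrite -compBl => /idealP[W1 [W1W [a [b gE]]]].
apply/qpiP; set h := g - g' in gE *.
have [V0 [W0 [x [w [V0V W0W [eta xw]]]]]] := rZ_plus r'.
have [rho rhoP] := r_conflation r.
have [a' a'E] := extend_along (a := a) rhoP (cot_ext0 _ (rU_U r) W1W.2).
have [|c cE] := hom_exactl (g := h - b \oc a') rhoP.
  by rewrite compBl gE a'E compA subrr.
have [c' c'E] := lift_along (c := c) xw (cot_ext0 _ (rU_U r) V0V).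
rewrite -(subrK (b \oc a') h) rpredD //; apply/idealP.
  by exists W0; split=> //; exists (c' \oc ru r), w; rewrite cE c'E compA.
by exists W1; split=> //; exists a', b.
Qed.

Lemma coreflection_ex A A' (r : coreflection_seq A) (r' : coreflection_seq A')
    (q : hom (p := BmodW) A A') :
  exists s : hom (p := BmodW) (cX r) (cX r'),
    (qpi cotW (cx r') : hom (p := BmodW) (cX r') A') \oc s =
    q \oc (qpi cotW (cx r) : hom (p := BmodW) (cX r) A).
Proof.
have [f ->] := qpi_surj q.
have [W0 [U0 [w [y [[W0U W0V] U0U [eta wy]]]]]] := cX_minus r.
pose f' := f \oc cx r.
have [th thE] := c_surj r' U0U (push f' eta).
have [M [k1 [k2 kth]]] := realizes_ex th.
have [rho rhoP] := c_conflation r'.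
have [K [d [e [h' [d2 [[h'k1 eh'] h'P de _ _]]]]]] := ET4 rhoP kth.
rewrite thE in de.
have [|k [kw ek]] := ET2_morphism (a := f') (c := idm U0) wy de.
  by rewrite pull1.
have [k' k'E] := lift_along (c := k) h'P (cot_ext0 _ W0U (cV_V r')).
have k2k' : k2 \oc k' = idm U0 \oc y by rewrite -ek k'E compA eh'.
have [g [k1g gth]] := ET3op wy kth k2k'.
have [|c cE] := extend_along (a := cx r' \oc g - f') wy.
  by rewrite pushBm pushM gth pull1 thE subrr.
exists (qpi cotW g); rewrite /= !qpi_comp; apply/qpiP.
by apply/idealP; exists W0; split; [split|exists w, c].
Qed.

Lemma coreflection_uniq A A' (r : coreflection_seq A) (r' : coreflection_seq A')
    (s s' : hom (p := BmodW) (cX r) (cX r')) :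
  (qpi cotW (cx r') : hom (p := BmodW) (cX r') A') \oc s =
  (qpi cotW (cx r') : hom (p := BmodW) (cX r') A') \oc s' -> s = s'.
Proof.
have [g ->] := qpi_surj s; have [g' ->] := qpi_surj s' => {s s'}.
rewrite /= !qpi_comp => /qpiP; rewrite -compBr => /idealP[W1 [W1W [a [b gE]]]].
apply/qpiP; set h := g - g' in gE *.
have [W0 [U0 [w [y [W0W U0U [eta wy]]]]]] := cX_minus r.
have [rho rhoP] := c_conflation r'.
have [b' b'E] := lift_along (c := b) rhoP (cot_ext0 _ W1W.1 (cV_V r')).
have [|c cE] := hom_exactr (g := h - b' \oc a) rhoP.
  by rewrite compBr gE b'E compA subrr.
have [c' c'E] := extend_along (a := c) wy (cot_ext0 _ U0U (cV_V r')).
rewrite -(subrK (b' \oc a) h) rpredD //; apply/idealP.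
  by exists W0; split=> //; exists w, (cv r' \oc c'); rewrite cE c'E compA.
by exists W1; split=> //; exists a, b'.
Qed.

Lemma cotV_perp X : (forall A (d : E A X), U A -> d = 0) -> V X.
Proof.
move=> X0; have [V0 [U0 [x [y [V0V U0U [d dxy]]]]]] := cot_right UV X.
apply: (cotV_summand V0V); exists U0, (asum X U0).
have sp := @ET2_split B X U0.
by have [b [ib _]] := (realizes_class x y sp).1
  (eq_ind _ (fun d => realizes d x y) dxy _ (X0 _ d U0U)); exists b.
Qed.

Lemma coreflection_plus A (r : coreflection_seq A) : Bplus A -> Bplus (cX r).
Proof.
move=> [V0 [W0 [x0 [w0 [V0V [W0U W0V] [eta xw]]]]]].
have [V1 [U1 [v1 [u1 [V1V U1U [d1 d1P]]]]]] := cot_left UV (cX r).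
have [d0 d0P] := c_conflation r.
have [K [d [e [h' [d2 [_ h'P de _ _]]]]]] := ET4op d1P d0P.
exists V1, U1, v1, u1; split=> //; last by exists d1.
split=> //; apply: cotV_perp => X b XU.
have [w wE] := lift_along (c := cx r \oc u1) xw (cot_ext0 _ U1U V0V).
have [|a ->] := ext_exact_push (b := b) h'P.
  by rewrite wE pushM (cot_ext0 (push w b) XU W0V) push0.
have [|a' ->] := ext_exact_push (b := a) de.
  exact: cot_ext0 XU (cV_V r).
by rewrite (cot_ext0 a' XU V1V) !push0.
Qed.

(* By the two lemmas on each side, sigma^+ q and sigma^- q are the unique
   morphisms of B/W making the defining square commute; [cid] picks them. *)
Section Functors.
Variables (p : reflection_choice) (m : coreflection_choice).

Definition sigma_plus_map (A A' : BmodW) (q : hom A A') :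
    hom (p := BmodW) (rZ (p A)) (rZ (p A')) :=
  sval (cid (reflection_ex (p A) (p A') q)).

Lemma sigma_plus_mapP (A A' : BmodW) (q : hom A A') :
  sigma_plus_map q \oc (qpi cotW (rz (p A)) : hom (p := BmodW) A (rZ (p A))) =
  (qpi cotW (rz (p A')) : hom (p := BmodW) A' (rZ (p A'))) \oc q.
Proof. exact: (svalP (cid (reflection_ex (p A) (p A') q))). Qed.

Lemma sigma_plus_map1 (A : BmodW) :
  sigma_plus_map (idm A) = idm (rZ (p A) : BmodW).
Proof.
by apply: reflection_uniq; rewrite sigma_plus_mapP compm1 comp1m.
Qed.

Lemma sigma_plus_mapM (A A' A'' : BmodW) (g : hom A' A'') (f : hom A A') :
  sigma_plus_map (g \oc f) = sigma_plus_map g \oc sigma_plus_map f.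
Proof.
apply: reflection_uniq.
by rewrite -compA !sigma_plus_mapP !compA sigma_plus_mapP.
Qed.

Definition sigma_plus : functor BmodW BplusW :=
  @Functor BmodW BplusW
    (fun A => exist Bplus (rZ (p A)) (rZ_plus (p A)))
    sigma_plus_map sigma_plus_map1 sigma_plus_mapM.

Definition sigma_minus_map (A A' : BmodW) (q : hom A A') :
    hom (p := BmodW) (cX (m A)) (cX (m A')) :=
  sval (cid (coreflection_ex (m A) (m A') q)).

Lemma sigma_minus_mapP (A A' : BmodW) (q : hom A A') :
  (qpi cotW (cx (m A')) : hom (p := BmodW) (cX (m A')) A')
    \oc sigma_minus_map q =
  q \oc (qpi cotW (cx (m A)) : hom (p := BmodW) (cX (m A)) A).
Proof. exact: (svalP (cid (coreflection_ex (m A) (m A') q))). Qed.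

Lemma sigma_minus_map1 (A : BmodW) :
  sigma_minus_map (idm A) = idm (cX (m A) : BmodW).
Proof.
by apply: coreflection_uniq; rewrite sigma_minus_mapP comp1m compm1.
Qed.

Lemma sigma_minus_mapM (A A' A'' : BmodW) (g : hom A' A'') (f : hom A A') :
  sigma_minus_map (g \oc f) = sigma_minus_map g \oc sigma_minus_map f.
Proof.
apply: coreflection_uniq.
by rewrite sigma_minus_mapP compA sigma_minus_mapP -!compA sigma_minus_mapP.
Qed.

Definition sigma_minus : functor BmodW BminusW :=
  @Functor BmodW BminusW
    (fun A => exist Bminus (cX (m A)) (cX_minus (m A)))
    sigma_minus_map sigma_minus_map1 sigma_minus_mapM.

Definition assoc_functor_BmodW : functor B BmodW :=
  functor_comp (functor_comp (@full_incl BmodW Bminus) sigma_minus)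
    (functor_comp (functor_comp (@full_incl BmodW Bplus) sigma_plus)
       (quot_functor cotW)).

Lemma assoc_functor_inH (A : B) : inH (assoc_functor_BmodW A).
Proof.
split; last exact: cX_minus.
exact/coreflection_plus/rZ_plus.
Qed.

Definition assoc_functor : functor B heart :=
  corestrict (P := inH : BmodW -> Prop) assoc_functor_inH.

End Functors.
End Heart.

Definition heart_equivalent (B : extriangulated) (UV UV' : cotorsion_pair B)
    (H : functor B (heart UV)) (H' : functor B (heart UV')) :=
  exists E : functor (heart UV) (heart UV'),
    is_equivalence E /\ nat_iso (functor_comp E H) H'.

Definition vanishes_on (B C : preadditive) (F : functor B C) (X : B -> Prop) :=
  forall A, X A -> exists2 Z : C, zero_object Z & isomorphic (F A) Z.

(* Main.v *)
(** H(A) = 0 exactly when A lies in K, so (2) and (3) agree because K is the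
    smallest extension- and summand-closed class containing U and V; closure
    under extensions holds since V * U splits.

    For (3) => (1), call f : A -> C good when A -> C + N is an inflation and A
    + N' -> C a deflation with N, N', the cone and the cocone in K.
    Reflections and coreflections are good, and so are composites. The functor
    H inverts good f: it suffices to treat a good morphism from B^- to B^+,
    whose transpose k : X -> Y in the heart is both epi and mono; then the
    cone C of k lies in U and its cocone D in V, and E(C, D) = 0 splits both
    conflations, so that k is invertible modulo W. As goodness depends only on
    K, the equality K = K' makes H' invert the reflections and coreflections
    of (U, V), whence H' restricted to the heart of (U, V) is the required
    equivalence. *)

From mathcomp Require Import all_boot all_algebra.
From mathcomp Require Import boolp.

Set Implicit Arguments.
Unset Strict Implicit.
Unset Printing Implicit Defensive.

Import GRing.Theory.
Require Import Defs.
Local Open Scope ring_scope.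

(** * Biproducts and isomorphisms *)

Section Preadditive.
Variable C : preadditive.
Implicit Types A B D M : C.

Lemma is_iso_idm A : is_iso (idm A).
Proof. by exists (idm A); rewrite comp1m. Qed.

Lemma is_iso_comp A B D (g : hom B D) (f : hom A B) :
  is_iso g -> is_iso f -> is_iso (g \oc f).
Proof.
move=> [g' [g'g gg']] [f' [f'f ff']]; exists (f' \oc g'); split.
  by rewrite compA -(compA f') g'g compm1.
by rewrite compA -(compA g) ff' compm1.
Qed.

Lemma is_iso_linv_rinv A B (f : hom A B) (l r : hom B A) :
  l \oc f = idm A -> f \oc r = idm B -> is_iso f.
Proof.
move=> lf fr; exists l; split=> //; rewrite -[RHS]fr; congr (f \oc _).
by rewrite -(compm1 l) -fr compA lf comp1m.
Qed.

Lemma is_iso_cancelr A B D (g : hom B D) (f : hom A B) :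
  is_iso (g \oc f) -> is_iso f -> is_iso g.
Proof.
move=> gf_iso [f' [f'f ff']].
have -> : g = g \oc f \oc f' by rewrite -compA ff' compm1.
by apply: is_iso_comp gf_iso _; exists f.
Qed.

Lemma isomorphic_sym A B : isomorphic A B -> isomorphic B A.
Proof. by move=> [f [g [gf fg]]]; exists g, f. Qed.

Definition swap_biproduct A B (S : biproduct A B) : biproduct B A.
Proof.
apply: (@Biproduct C B A S (bin2 S) (bin1 S) (bpr2 S) (bpr1 S));
  rewrite ?bpr1in1 ?bpr2in2 ?bpr1in2 ?bpr2in1 //.
by rewrite addrC binpr.
Defined.

Definition assoc_biproduct A B D (S : biproduct A B) (T : biproduct S D)
    (R : biproduct B D) : biproduct A R.
Proof.
apply: (@Biproduct C A R T (bin1 T \oc bin1 S)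
   (bin1 T \oc bin2 S \oc bpr1 R + bin2 T \oc bpr2 R)
   (bpr1 S \oc bpr1 T)
   (bin1 R \oc bpr2 S \oc bpr1 T + bin2 R \oc bpr2 T)).
- by rewrite compA -(compA (bpr1 S)) bpr1in1 compm1 bpr1in1.
- rewrite compDl !compDr -!compA.
  rewrite !(compA (bpr1 T)) !(compA (bpr2 T)) bpr1in1 bpr1in2 bpr2in1 bpr2in2.
  rewrite !comp1m !comp0l !comp0r !(compA (bpr2 S)) bpr2in2 !comp1m.
  by rewrite addr0 add0r binpr.
- rewrite compDr -!compA !(compA (bpr1 T)) bpr1in1 bpr1in2 comp1m comp0l.
  by rewrite comp0r addr0 compA bpr1in2 comp0l.
- rewrite compDl -!compA !(compA (bpr1 T)) !(compA (bpr2 T)) bpr1in1 bpr2in1.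
  by rewrite comp1m comp0l bpr2in1 !comp0r addr0.
- rewrite compDl !compDr -!compA.
  rewrite !(compA (bpr1 R)) !(compA (bpr2 R)) bpr1in1 bpr1in2 bpr2in1 bpr2in2.
  rewrite !comp1m !comp0l !comp0r addr0 add0r.
  rewrite !compA addrA -compDl -(compA (bin1 T) (bin1 S)).
  by rewrite -(compA (bin1 T) (bin2 S)) -compDr binpr compm1 binpr.
Defined.

Lemma biproduct_iso A B (S T : biproduct A B) :
  exists f : hom S T,
    [/\ is_iso f, f \oc bin1 S = bin1 T, bpr1 T \oc f = bpr1 S &
        bpr2 T \oc f = bpr2 S].
Proof.
exists (bin1 T \oc bpr1 S + bin2 T \oc bpr2 S); split.
- have inv (X Y : biproduct A B) :
    (bin1 Y \oc bpr1 X + bin2 Y \oc bpr2 X) \oc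
    (bin1 X \oc bpr1 Y + bin2 X \oc bpr2 Y) = idm Y.
    rewrite compDl !compDr -!compA !(compA (bpr1 X)) !(compA (bpr2 X)).
    rewrite bpr1in1 bpr1in2 bpr2in1 bpr2in2 !comp1m !comp0l !comp0r.
    by rewrite addr0 add0r binpr.
  by exists (bin1 S \oc bpr1 T + bin2 S \oc bpr2 T); split; apply: inv.
- by rewrite compDl -!compA bpr1in1 bpr2in1 compm1 comp0r addr0.
- by rewrite compDr !compA bpr1in1 bpr1in2 comp1m comp0l addr0.
- by rewrite compDr !compA bpr2in1 bpr2in2 comp1m comp0l add0r.
Qed.

End Preadditive.

(** * Realizations *)

Section Realizations.
Variable B : extriangulated.
Implicit Types A C D M X Y : B.
Local Notation E := (E_ B).

Lemma realizes_conflation A C M (d : E C A) (x : hom A M) (y : hom M C) :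
  realizes d x y -> conflation x y.
Proof. by exists d. Qed.

Lemma push_infl0 A C M (d : E C A) (x : hom A M) (y : hom M C) :
  realizes d x y -> push x d = 0.
Proof.
move=> dP; have sp := @ET2_split B M (azero B).
have [c [_ ->]] := ET3 (a := x) (b := bin1 (asum M (azero B))) dP sp erefl.
exact: pull0.
Qed.

Lemma pull_defl0 A C M (d : E C A) (x : hom A M) (y : hom M C) :
  realizes d x y -> pull y d = 0.
Proof.
move=> dP; have sp := @ET2_split B (azero B) M.
have [a [_ <-]] := ET3op (b := bpr2 (asum (azero B) M)) (c := y) sp dP erefl.
exact: push0.
Qed.

Lemma realizes_seq_equiv A C M M' (d : E C A) (x : hom A M) (y : hom M C)
    (x' : hom A M') (y' : hom M' C) :
  realizes d x y -> seq_equiv x y x' y' -> realizes d x' y'.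
Proof. by move=> dP e; apply/(realizes_class _ _ dP). Qed.

Lemma realizes_biproduct A C (S : biproduct A C) :
  realizes (0 : E C A) (bin1 S) (bpr2 S).
Proof.
apply: realizes_seq_equiv (@ET2_split B A C) _.
by have [f [fi f1 _ f2]] := biproduct_iso (asum A C) S; exists f.
Qed.

Lemma realizes_mid_iso A C M M' (d : E C A) (x : hom A M) (y : hom M C)
    (b : hom M M') (b' : hom M' M) :
  b' \oc b = idm M -> b \oc b' = idm M' -> realizes d x y ->
  realizes d (b \oc x) (y \oc b').
Proof.
move=> b'b bb' dP; apply: realizes_seq_equiv dP _.
by exists b; split; [exists b'|rewrite -compA b'b compm1].
Qed.

(** The difference [b - idm M] has the form [c \oc y] with [y \oc c \oc y = 0], so it squares to
    zero and [idm M - c \oc y] inverts [b]. *)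
Lemma realizes_endo_iso A C M (d : E C A) (x : hom A M) (y : hom M C)
    (b : hom M M) :
  realizes d x y -> b \oc x = x -> y \oc b = y -> is_iso b.
Proof.
move=> dP bx yb.
have [|c cE] := hom_exactl (g := b - idm M) dP.
  by rewrite compBl bx comp1m subrr.
have ycy : y \oc c \oc y = 0 by rewrite -compA -cE compBr yb compm1 subrr.
have -> : b = idm M + c \oc y by rewrite -cE addrC subrK.
have sq : c \oc y \oc (c \oc y) = 0 by rewrite -compA (compA y) ycy comp0r.
exists (idm M - c \oc y); rewrite !compDl !compDr !compNl !compNr sq.
by rewrite !comp1m !compm1 oppr0 !addr0 subrK addrK.
Qed.

(** Any realization of [pull c d] maps to [(x, y)] along [c] and back along [c']; both composites
    fix the end terms, hence are invertible. *)
Lemma realizes_pull_iso A C C' M (d : E C A) (x : hom A M) (y : hom M C)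
    (c : hom C' C) (c' : hom C C') :
  c' \oc c = idm C' -> c \oc c' = idm C -> realizes d x y ->
  realizes (pull c d) x (c' \oc y).
Proof.
move=> c'c cc' dP; have [N [n [n' nP]]] := realizes_ex (pull c d).
have [|b [bn yb]] := ET2_morphism (a := idm A) (c := c) nP dP.
  by rewrite push1.
have [|b' [b'x nb']] := ET2_morphism (a := idm A) (c := c') dP nP.
  by rewrite push1 -pullM cc' pull1.
move: bn b'x; rewrite !compm1 => bn b'x.
have b'b : is_iso (b' \oc b).
  apply: (realizes_endo_iso nP); first by rewrite -compA bn.
  by rewrite compA nb' -compA yb compA c'c comp1m.
have bb' : is_iso (b \oc b').
  apply: (realizes_endo_iso dP); first by rewrite -compA b'x.
  by rewrite compA yb -compA nb' compA cc' comp1m.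
apply: realizes_seq_equiv nP _; exists b; split; last first.
  by split=> //; rewrite -compA yb compA c'c comp1m.
have [l [lE _]] := b'b; have [r [_ rE]] := bb'.
apply: (is_iso_linv_rinv (l := l \oc b') (r := b' \oc r)).
  by rewrite -compA.
by rewrite compA.
Qed.

End Realizations.

(** * The opposite extriangulated category *)

Section Opposite.

Definition op_pre (C : preadditive) : preadditive :=
  @Preadditive C (fun A B => hom B A) (fun A => idm A)
    (fun A B D g f => f \oc g)
    (fun A B f => compm1 f) (fun A B f => comp1m f)
    (fun A B D F h g f => esym (compA f g h))
    (fun A B D g g' f => compDr f g g') (fun A B D g f f' => compDl f f' g).

Definition op_biproduct (C : preadditive) (A B : C) (S : biproduct A B) :
    @biproduct (op_pre C) A B :=
  @Biproduct (op_pre C) A B S (bpr1 S) (bpr2 S) (bin1 S) (bin2 S)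
    (bpr1in1 S) (bpr2in2 S) (bpr2in1 S) (bpr1in2 S) (binpr S).

Lemma op_azeroP (B : additive) : @zero_object (op_pre B) (azero B).
Proof. by move=> A; have [? ?] := azeroP A. Qed.

Definition op_additive (B : additive) : additive :=
  @Additive (op_pre B) (azero B) (@op_azeroP B)
    (fun A A' => op_biproduct (asum A A')).

Definition op_ext (B : preadditive) (E : ext_bifunctor B) :
    ext_bifunctor (op_pre B) :=
  @ExtBifunctor (op_pre B) (fun C A => E A C)
    (fun C A A' (a : @hom B A' A) (d : E A C) => pull a d)
    (fun C C' A (c : @hom B C C') (d : E A C) => push c d)
    (fun C A d => pull1 d) (fun C A d => push1 d)
    (fun C A A' A'' (a' : @hom B A'' A') (a : @hom B A' A) (d : E A C) =>
       pullM a a' d)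
    (fun C C' C'' A (c : @hom B C C') (c' : @hom B C' C'') (d : E A C) =>
       pushM c' c d)
    (fun C C' A A' (a : @hom B A' A) (c : @hom B C C') (d : E A C) =>
       esym (push_pull c a d))
    (fun C A A' (a : @hom B A' A) (d d' : E A C) => pullD a d d')
    (fun C C' A (c : @hom B C C') (d d' : E A C) => pushD c d d')
    (fun C A A' (a a' : @hom B A' A) (d : E A C) => pullDm a a' d)
    (fun C C' A (c c' : @hom B C C') (d : E A C) => pushDm c c' d).

Lemma op_sum_hom (B : additive) (A A' C C' : B) (f : hom A C) (f' : hom A' C') :
  @sum_hom (op_additive B) C C' A A' f f' = sum_hom f f'.
Proof. by rewrite /sum_hom /= !compA. Qed.

Lemma op_sum_ext (B : additive) (E : ext_bifunctor B) (A A' C C' : B)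
    (d : E C A) (d' : E C' A') :
  @sum_ext (op_additive B) (op_ext E) C C' A A' d d' = sum_ext d d'.
Proof. by rewrite /sum_ext /= -!push_pull. Qed.

Definition op_realizes (B : extriangulated) (A C : op_additive B)
    (d : op_ext (E_ B) C A) M (x : hom A M) (y : hom M C) : Prop :=
  @realizes B C A d M y x.

Lemma seq_equiv_op (C : preadditive) (A D M M' : C)
    (x : hom A M) (y : hom M D) (x' : hom A M') (y' : hom M' D) :
  @seq_equiv (op_pre C) D A M M' y x y' x' <-> seq_equiv x y x' y'.
Proof.
split=> -[b [[g [bg gb]] [bx yb]]]; exists g; split; try by exists b.
  move: bg gb bx yb => /= bg gb bx yb.
  by rewrite -bx -yb compA gb comp1m -compA bg compm1.
by rewrite /= -bx -yb compA bg comp1m -compA gb compm1.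
Qed.

Section OppositeExtriangulated.
Variable B : extriangulated.
Local Notation A := (op_additive B).

Lemma op_realizes_ex (X Y : A) (d : op_ext (E_ B) Y X) :
  exists M (x : hom X M) (y : hom M Y), op_realizes d x y.
Proof. by have [M [x [y dP]]] := @realizes_ex B Y X d; exists M, y, x. Qed.

(** Inflations and deflations trade places, so (ET3) and (ET4) come from their duals. [Defined]
    keeps the structure transparent: statements over the opposite category convert to dual
    statements over [B]. *)
Definition op_extriangulated : extriangulated.
Proof.
apply: (@Extriangulated A (op_ext (E_ B)) (@op_realizes B)).
- exact: op_realizes_ex.
- move=> X Y d M x y M' x' y' dP.
  split=> [/(realizes_class _ _ dP)/seq_equiv_op //|].
  by move/seq_equiv_op/(realizes_class _ _ dP).
- move=> X Y d M x y X' Y' d' M' x' y' a c dP dP' ad.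
  have [b [bx yb]] := ET2_morphism dP' dP (esym ad).
  by exists b.
(* The opposite split sequence is [bin2] followed by [bpr1], the split sequence of the swapped
   biproduct. *)
- move=> X Y; exact: (realizes_biproduct (swap_biproduct (@asum B X Y))).
- move=> X Y d M x y X' Y' d' M' x' y' dP dP'.
  have := ET2_sum dP dP'.
  by rewrite /op_realizes op_sum_ext !op_sum_hom.
- move=> X Y d M x y X' Y' d' M' x' y' a b dP dP' ab.
  have [c [cy ad]] := ET3op dP' dP ab.
  by exists c.
- move=> X Y d M x y X' Y' d' M' x' y' b c dP dP' bc.
  have [a [xa ad]] := ET3 dP' dP bc.
  by exists a.
- move=> X Y Z D F d0 d1 f f' g g' d0P d1P.
  have [R [d [e [h' [d2 [[E1 E2] E3 E4 E5 E6]]]]]] := ET4op d1P d0P.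
  by exists R, e, d, h', d2.
- move=> X Y Z D F d0 d1 f' f g' g d0P d1P.
  have [R [d [e [h' [d2 [[E1 E2] E3 E4 E5 E6]]]]]] := ET4 d1P d0P.
  by exists R, e, d, h', d2.
Defined.

End OppositeExtriangulated.

End Opposite.

(** * Conflations built from biproducts: sums, mapping cones, lifts *)

Lemma idm_azero (B : additive) : idm (azero B) = 0.
Proof. exact/zero_objectP/azeroP. Qed.

Lemma bin1_bpr1_azero (B : additive) (Y : B) (S : biproduct Y (azero B)) :
  bin1 S \oc bpr1 S = idm S.
Proof.
rewrite -[RHS](binpr S); have -> : bin2 S = 0; last by rewrite comp0l addr0.
by rewrite -(compm1 (bin2 S)) idm_azero comp0r.
Qed.

Definition biproduct0 (B : additive) (Y : B) : biproduct Y (azero B).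
Proof.
apply: (@Biproduct B Y (azero B) Y (idm Y) 0 (idm Y) 0);
  by rewrite ?idm_azero ?comp1m ?comp0r ?comp0l ?addr0.
Defined.

Definition graph_biproduct (C : preadditive) (A B : C) (S : biproduct A B)
    (f : hom A B) : biproduct A B.
Proof.
apply: (@Biproduct C A B S (bin1 S + bin2 S \oc f) (bin2 S) (bpr1 S)
   (bpr2 S - f \oc bpr1 S)).
- by rewrite compDr compA bpr1in1 bpr1in2 comp0l addr0.
- by rewrite compBl -compA bpr2in2 bpr1in2 comp0r subr0.
- exact: bpr1in2.
- rewrite compBl !compDr -!compA bpr1in1 bpr2in1 compA bpr2in2 comp1m.
  by rewrite (compA (bpr1 S)) bpr1in2 comp0l comp0r compm1 add0r addr0 subrr.
- by rewrite compDl compBr (compA (bin2 S) f) addrAC addrA subrK binpr.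
Defined.

Section Constructions.
Variable B : extriangulated.
Implicit Types A C D M X Y W : B.
Local Notation E := (E_ B).

Lemma pushNm A A' C (a : hom A A') (d : E C A) : push (- a) d = - push a d.
Proof.
by apply: (@addrI _ (push a d)); rewrite -pushDm !subrr -(subrr a) pushBm subrr.
Qed.

Lemma pushN A A' C (a : hom A A') (d : E C A) : push a (- d) = - push a d.
Proof. by apply: (@addrI _ (push a d)); rewrite -pushD !subrr push0. Qed.

Lemma pullN A C C' (c : hom C' C) (d : E C A) : pull c (- d) = - pull c d.
Proof. by apply: (@addrI _ (pull c d)); rewrite -pullD !subrr pull0. Qed.

Lemma realizes_idm Y : realizes (0 : E (azero B) Y) (idm Y) 0.
Proof. exact: (realizes_biproduct (biproduct0 Y)). Qed.

Lemma realizes_comp0 A C M (d : E C A) (x : hom A M) (y : hom M C) :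
  realizes d x y -> y \oc x = 0.
Proof.
move=> dP.
have [c [<- _]] := ET3 (a := idm A) (b := x) (realizes_idm A) dP erefl.
exact: comp0r.
Qed.

(** The sum with [Y -> Y -> 0], after which [realizes_pull_iso] shrinks the end term [C + 0] to
    [C]. *)
Lemma realizes_sum_idm X W C Y (d : E C X) (x : hom X W) (y : hom W C) :
  realizes d x y ->
  realizes (push (bin1 (asum X Y)) d) (sum_hom x (idm Y))
    (y \oc bpr1 (asum W Y)).
Proof.
move=> dP; have sP := ET2_sum dP (realizes_idm Y).
have iS := bin1_bpr1_azero (asum C (azero B)).
set S := asum C (azero B) in sP iS.
have := realizes_pull_iso (bpr1in1 S) iS sP.
rewrite /sum_ext /sum_hom !pullD -!push_pull -!pullM bpr1in1 pull1 !pull0 push0.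
rewrite addr0 compDr !compA bpr1in1 bpr1in2 comp1m comp0l comp0l addr0.
by [].
Qed.

(** (ET4) is applied to the graph [X -> X + Y] of [f] and to [X + Y -> W + Y], whose composite is
    [(x, f)]. The graph has cokernel map [bpr2 - f \oc bpr1], whence the sign in [- push f d]. *)
Lemma mapping_cone X W C Y (S : biproduct W Y) (d : E C X) (x : hom X W)
    (y : hom W C) (f : hom X Y) :
  realizes d x y ->
  exists D (b : hom S D) (q : hom D C),
    [/\ conflation (bin1 S \oc x + bin2 S \oc f) b,
        realizes (- push f d) (b \oc bin2 S) q & q \oc b = y \oc bpr1 S].
Proof.
move=> dP; have gP := realizes_biproduct (graph_biproduct (asum X Y) f).
have [D [e [q [h [d2 [[hg qh] d2P eP _ _]]]]]] :=
  ET4 gP (realizes_sum_idm Y dP).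
(* The rest transports the result from the chosen sum to an arbitrary biproduct [S]. *)
have [k [[k' [k'k kk']] kin1 pr1k pr2k]] := biproduct_iso (asum W Y) S.
have kin2 : k \oc bin2 (asum W Y) = bin2 S.
  rewrite -[LHS]comp1m -(binpr S) compDl !compA -(compA _ _ k) pr1k.
  rewrite -(compA _ _ k) pr2k -!compA bpr1in2 bpr2in2 comp0r add0r compm1.
  by [].
exists D, (h \oc k'), q; split.
- exists d2; have := realizes_mid_iso k'k kk' d2P; congr realizes.
  rewrite /= /sum_hom !compDl !compDr -!compA !comp1m.
  rewrite !(compA (bpr1 (asum X Y))) !(compA (bpr2 (asum X Y))).
  rewrite bpr1in1 bpr1in2 bpr2in1 bpr2in2 !comp1m !comp0l !comp0r.
  by rewrite !addr0 add0r !compA kin1 kin2 compm1.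
- rewrite -compA -kin2 (compA k') k'k comp1m.
  have -> : h \oc bin2 (asum W Y) = e.
    have := congr1 (fun z => z \oc bin2 (asum X Y)) hg.
    rewrite /= /sum_hom -!compA compBl -!compA bpr2in2 bpr1in2 comp0r subr0.
    rewrite compm1.
    by rewrite compDl -!compA bpr1in2 bpr2in2 !comp0r add0r !compm1.
  move: eP; rewrite -pushM /= compBl bpr2in1 -compA bpr1in1 compm1 sub0r.
  by rewrite pushNm.
- rewrite compA qh -!compA; congr (y \oc _).
  by rewrite -pr1k -compA kk' compm1.
Qed.

(* The pullback of t along t x splits since x is a lift; this stands in for the
   missing shift of V0. *)
Lemma octahedral_lift V0 M M' X C (v : hom V0 M') (t : hom M' M)
    (x : hom X M') (y : hom M C) :
  conflation v t -> conflation (t \oc x) y ->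
  exists C' (y' : hom M' C') (v' : hom V0 C') (t' : hom C' C),
    conflation x y' /\ conflation v' t'.
Proof.
move=> [d0 d0P] [d1 d1P].
have [P [d [e [h [d2 [[th hd] d2P deP _ _]]]]]] := ET4op d0P d1P.
have p0 : pull (t \oc x) d0 = 0 by rewrite pullM (pull_defl0 d0P) pull0.
rewrite p0 in deP.
have [|s0 s0E] := lift_along (c := idm X) deP; first by rewrite pull0.
have [|r0 r0E] := extend_along (a := idm V0) deP; first by rewrite push0.
have [|a aE] := hom_exactr (g := h \oc s0 - x) d0P.
  by rewrite compBr compA th -!compA -s0E compm1 subrr.
(* Subtracting a map through [d] keeps [s] a section of [e] and makes its composite with [h] equal
   to [x]. *)
pose s := s0 - d \oc a.
have ed := realizes_comp0 deP.
have es : e \oc s = idm X by rewrite compBr -s0E compA ed comp0l subr0.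
have hs : h \oc s = x by rewrite compBr compA hd -aE subKr.
have [|r rE] := hom_exactr (g := idm P - s \oc e) deP.
  by rewrite compBr compm1 compA es comp1m subrr.
have rE' : r = r0 \oc (idm P - s \oc e) by rewrite rE compA -r0E comp1m.
have rd : r \oc d = idm V0.
  by rewrite rE' -compA compBl comp1m -compA ed comp0r subr0.
have rs : r \oc s = 0.
  by rewrite rE' -compA compBl comp1m -compA es compm1 subrr comp0r.
have sredP : s \oc e + d \oc r = idm P by rewrite -rE addrC subrK.
(* [P] is now split as [X + V0]; (ET4) on [X -> P -> V0] and [P -> M' -> C] produces [C']. *)
have sP := realizes_biproduct (Biproduct es rd ed rs sredP).
have [C' [v' [t' [y' [d3 [_ xP vP _ _]]]]]] := ET4 sP d2P.
by exists C', y', v', t'; split; [exists d3; rewrite -hs|exists (push r d2)].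
Qed.

End Constructions.

Lemma realizes_sum_idm_defl (B : extriangulated) (A M C Y : B) (d : E_ B C A)
    (x : hom A M) (y : hom M C) :
  realizes d x y ->
  realizes (pull (bpr1 (asum C Y)) d) (bin1 (asum M Y) \oc x)
    (sum_hom y (idm Y)).
Proof.
move=> dP; rewrite -op_sum_hom.
exact: (@realizes_sum_idm (op_extriangulated B) C M A Y d y x dP).
Qed.

(** * Cotorsion pairs *)

Section OppositeCotorsion.
Variables (B : extriangulated) (UV : cotorsion_pair B).
Local Notation Bop := (op_extriangulated B).

Lemma op_isomorphic (C : preadditive) (A X : C) :
  @isomorphic (op_pre C) A X <-> isomorphic A X.
Proof. by split=> -[f [g [gf fg]]]; exists g, f. Qed.

Lemma op_summand (C : preadditive) (A X : C) :
  @summand (op_pre C) A X <-> summand A X.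
Proof.
split=> -[A' [S SX]].
  exists A', (@Biproduct C A A' S (bpr1 S) (bpr2 S) (bin1 S) (bin2 S)
    (bpr1in1 S) (bpr2in2 S) (bpr2in1 S) (bpr1in2 S) (binpr S)).
  exact/op_isomorphic.
by exists A', (op_biproduct S); apply/op_isomorphic.
Qed.

Definition op_sub (P : additive_sub B) : additive_sub Bop :=
  @AdditiveSub Bop P (mem_sub0 P) (fun A A' PA PA' => mem_subD PA PA').

Definition op_cotorsion : cotorsion_pair Bop.
Proof.
apply: (@CotorsionPair Bop (op_sub (cotV UV)) (op_sub (cotU UV))).
- by move=> A X VX /op_summand; apply: cotV_summand.
- by move=> A X UX /op_summand; apply: cotU_summand.
- by move=> A X VX /op_isomorphic; apply: cotV_iso.
- by move=> A X UX /op_isomorphic; apply: cotU_iso.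
- by move=> X Y d VX UY; apply: (@cot_ext0 B UV Y X d).
- move=> A; have [X [Y [x [y [VX UY xy]]]]] := cot_right UV A.
  by exists Y, X, y, x; split.
- move=> A; have [X [Y [x [y [VX UY xy]]]]] := cot_left UV A.
  by exists Y, X, y, x; split.
Defined.

Lemma op_factors (A C : B) (f : hom A C) :
  @factors Bop (cotW op_cotorsion) C A f <-> factors (cotW UV) f.
Proof.
by split=> -[X [[WX WX'] [g [h fE]]]]; exists X; split=> //; exists h, g.
Qed.

Lemma op_Bplus (A : B) : Bplus op_cotorsion A <-> Bminus UV A.
Proof.
split; first by move=> [X [Y [x [y [? [? ?] xy]]]]]; exists Y, X, y, x.
by move=> [X [Y [x [y [[? ?] ? xy]]]]]; exists Y, X, y, x.
Qed.

Lemma op_Bminus (A : B) : Bminus op_cotorsion A <-> Bplus UV A.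
Proof.
split; last by move=> [X [Y [x [y [? [? ?] xy]]]]]; exists Y, X, y, x.
by move=> [X [Y [x [y [[? ?] ? xy]]]]]; exists Y, X, y, x.
Qed.

Lemma op_extension (P Q : B -> Prop) (A : B) :
  @extension Bop P Q A <-> extension Q P A.
Proof. by split=> -[X [Y [x [y [? ? xy]]]]]; exists Y, X, y, x. Qed.

Lemma op_kernel (A : B) : kernel op_cotorsion A <-> kernel UV A.
Proof.
by split=> -[M /op_extension eM /op_summand sM]; exists M.
Qed.

Definition op_reflection (A : B) (r : reflection_seq UV A) :
    @coreflection_seq Bop op_cotorsion A :=
  @CoreflectionSeq Bop op_cotorsion A (rZ r) (rz r) (rU r) (ru r)
    (r_conflation r) ((op_Bminus _).2 (rZ_plus r)) (rU_U r)
    (fun X VX d => r_surj r VX d).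

Definition op_coreflection (A : B) (c : coreflection_seq UV A) :
    @reflection_seq Bop op_cotorsion A :=
  @ReflectionSeq Bop op_cotorsion A (cX c) (cx c) (cV c) (cv c)
    (c_conflation c) ((op_Bplus _).2 (cX_minus c)) (cV_V c)
    (fun X UX d => c_surj c UX d).

End OppositeCotorsion.

Section Cotorsion.
Variables (B : extriangulated) (UV : cotorsion_pair B).
Implicit Types A C D M N X Y Z : B.
Local Notation E := (E_ B).
Local Notation U := (cotU UV).
Local Notation V := (cotV UV).

Lemma cotU_perp X : (forall A (d : E X A), V A -> d = 0) -> U X.
Proof. exact: (@cotV_perp (op_extriangulated B) (op_cotorsion UV) X). Qed.

Lemma cotV_extension A C M (x : hom A M) (y : hom M C) :
  conflation x y -> V A -> V C -> V M.
Proof.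
move=> [d dP] VA VC; apply: (cotV_perp (UV := UV)) => X b UX.
have [|a ->] := ext_exact_push (b := b) dP; first exact: cot_ext0 UX VC.
by rewrite (cot_ext0 a UX VA) push0.
Qed.

End Cotorsion.

Lemma cotU_extension B (UV : cotorsion_pair B) (A C M : B) (x : hom A M)
    (y : hom M C) :
  conflation x y -> cotU UV A -> cotU UV C -> cotU UV M.
Proof.
move=> xy UA UC.
exact: (@cotV_extension (op_extriangulated B) (op_cotorsion UV) C A M y x).
Qed.

(** * Closure of the kernel under extensions *)

Section Kernel.
Variables (B : extriangulated) (UV : cotorsion_pair B).
Implicit Types A C D M N X Y Z : B.
Local Notation E := (E_ B).
Local Notation U := (cotU UV).
Local Notation V := (cotV UV).
Local Notation K := (kernel UV).

(* Conflations V1 -> F -> U2 split, so U * V * U * V = U * U * V * V. *)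
Lemma extension_UV_closed A C M (x : hom A M) (y : hom M C) :
  conflation x y -> extension U V A -> extension U V C -> extension U V M.
Proof.
move=> [d dP] [U1 [V1 [i1 [j1 [UU1 VV1 [d1 d1P]]]]]].
move=> [U2 [V2 [i2 [j2 [UU2 VV2 [d2 d2P]]]]]].
(* [M] is filtered with factors [U1], [V1], [U2], [V2]: [R] is an extension of [U2] by [A] with
   quotient [V2] in [M], and [F] is the quotient of [R] by [U1]. *)
have [R [a [b [h [e [_ eP abP _ _]]]]]] := ET4op dP d2P.
have [F [a' [b' [h' [e' [_ e'P ab'P _ _]]]]]] := ET4 d1P abP.
have /(realizes_class _ _ (@ET2_split B V1 U2)) : realizes (0 : E U2 V1) a' b'.
  by move: ab'P; rewrite (cot_ext0 (push _ _) UU2 VV1).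
move=> [k [[k' [k'k kk']] _]].
(* As [F] splits, its two factors can be read in the opposite order. *)
have sP := realizes_mid_iso k'k kk'
  (realizes_biproduct (swap_biproduct (asum V1 U2))).
have [G [a3 [b3 [h3 [e3 [_ e3P ab3P _ _]]]]]] := ET4op e'P sP.
have [L [a4 [b4 [h4 [e4 [_ e4P ab4P _ _]]]]]] := ET4 e3P eP.
exists G, L, (h \oc h3), h4; split; last by exists e4.
  by apply: (cotU_extension (x := a3) (y := b3)) UU1 UU2; eexists; exact: ab3P.
by apply: (cotV_extension (x := a4) (y := b4)) VV1 VV2; eexists; exact: ab4P.
Qed.

Lemma extension_iso (P Q : B -> Prop) A M :
  extension P Q A -> isomorphic A M -> extension P Q M.
Proof.
move=> [X [Y [x [y [PX QY [d dP]]]]]] [f [g [gf fg]]].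
exists X, Y, (f \oc x), (y \oc g); split=> //.
by exists d; apply: realizes_mid_iso.
Qed.

Lemma kernelP A :
  K A <-> exists A', extension U V (asum A A').
Proof.
split=> [[M eM [A' [S SM]]]|[A' eA]].
  exists A'; apply: (extension_iso eM); apply: isomorphic_sym.
  have [f [fi _ _ _]] := biproduct_iso (asum A A') S.
  by have [g gi] := SM; exists (g \oc f); apply: is_iso_comp.
exists (asum A A') => //; exists A', (asum A A').
by exists (idm _); apply: is_iso_idm.
Qed.

(** Adding the complements [A'] and [C'] to the end terms puts both in [U * V]; the new middle term
    lies there too and has [M] as a summand. *)
Lemma kernel_extension A C M (x : hom A M) (y : hom M C) :
  conflation x y -> K A -> K C -> K M.
Proof.
move=> [d dP] /kernelP[A' eA] /kernelP[C' eC].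
have dP' := realizes_sum_idm A' dP.
have dP2 := realizes_sum_idm_defl C' dP'.
have eM := extension_UV_closed (realizes_conflation dP2) eA eC.
exists (asum (asum M A') C') => //.
exists (asum A' C'), (assoc_biproduct (asum (asum M A') C') (asum A' C')).
by exists (idm _); apply: is_iso_idm.
Qed.

Lemma cotU_kernel A : U A -> K A.
Proof.
move=> UA; exists A; first by exists A, (azero B), (idm A), 0; split=> //;
  [exact: mem_sub0 | exists 0; exact: realizes_idm].
by exists (azero B), (biproduct0 A), (idm _); apply: is_iso_idm.
Qed.

End Kernel.

Lemma cotV_kernel B (UV : cotorsion_pair B) (A : B) :
  cotV UV A -> kernel UV A.
Proof.
move=> VA; apply/op_kernel.
exact: (@cotU_kernel (op_extriangulated B) (op_cotorsion UV)).
Qed.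

(** * Morphisms that factor through W *)

Section Ideal.
Variables (B : additive) (W : additive_sub B).

Lemma factorsD (A C : B) (f g : hom A C) :
  factors W f -> factors W g -> factors W (f + g).
Proof. by move=> /idealP fW /idealP gW; apply/idealP/rpredD. Qed.

Lemma factorsN (A C : B) (f : hom A C) : factors W f -> factors W (- f).
Proof. by move=> /idealP fW; apply/idealP; rewrite rpredN. Qed.

Lemma factors_compl (A C D : B) (g : hom C D) (f : hom A C) :
  factors W f -> factors W (g \oc f).
Proof. by move=> /idealP fW; apply/idealP/ideal_compl. Qed.

Lemma factors_compr (A C D : B) (g : hom C D) (f : hom A C) :
  factors W g -> factors W (g \oc f).
Proof. by move=> /idealP gW; apply/idealP/ideal_compr. Qed.

Lemma factors_through (A C X : B) (h : hom X C) (g : hom A X) :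
  W X -> factors W (h \oc g).
Proof. by move=> WX; exists X; split=> //; exists g, h. Qed.

End Ideal.

Section Factorization.
Variables (B : extriangulated) (UV : cotorsion_pair B).
Implicit Types A C D M N X Y Z : B.
Local Notation E := (E_ B).
Local Notation U := (cotU UV).
Local Notation V := (cotV UV).
Local Notation W := (cotW UV).
Local Notation K := (kernel UV).

(** The obstruction to lifting [f] along [w] lies in E(X, V0) = 0. *)
Lemma cotU_Bplus_factors X Y (f : hom X Y) : U X -> Bplus UV Y -> factors W f.
Proof.
move=> UX [V0 [W0 [x [w [VV0 WW0 [d dP]]]]]].
have [f' ->] := lift_along (c := f) dP (cot_ext0 _ UX VV0).
exact: factors_through.
Qed.

Lemma extension_factors X M Y (f : hom X M) (g : hom M Y) :
  Bminus UV X -> Bplus UV Y -> extension U V M -> factors W (g \oc f).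
Proof.
move=> [W0 [U0 [w [y [[WU WV] UU0 [d dP]]]]]] Yp.
move=> [U1 [V1 [i [v [UU1 VV1 [d1 d1P]]]]]].
have [c cE] := extend_along (a := v \oc f) dP (cot_ext0 _ UU0 VV1).
have [N [i' [w' nP]]] := realizes_ex (pull c d1).
have [|b [_ vb]] := ET2_morphism (a := idm U1) (c := c) nP d1P.
  by rewrite push1.
have [|l lE] := lift_along (c := w) nP.
  by rewrite -pullM -cE pullM (pull_defl0 d1P) pull0.
have [|a aE] := hom_exactr (g := f - b \oc l) d1P.
  by rewrite compBr cE compA vb -compA -lE subrr.
have UN := cotU_extension (realizes_conflation nP) UU1 WU.
rewrite -(subrK (b \oc l) f) aE compDr !compA.
by apply: factorsD; apply/factors_compr/cotU_Bplus_factors.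
Qed.

Lemma kernel_factors X M Y (f : hom X M) (g : hom M Y) :
  Bminus UV X -> Bplus UV Y -> K M -> factors W (g \oc f).
Proof.
move=> Xm Yp /kernelP[M' eM]; set S := asum M M' in eM.
have := extension_factors (bin1 S \oc f) (g \oc bpr1 S) Xm Yp eM.
by rewrite -compA (compA (bpr1 S)) bpr1in1 comp1m.
Qed.

(* N comes from cX -> N -> U0; the coreflection property then kills E(U, C),
   which puts C in V. *)
Lemma coreflection_cone A (c : coreflection_seq UV A) :
  exists N C (x : hom (cX c) (asum A N)) (y : hom (asum A N) C),
    [/\ W N, V C, conflation x y & bpr1 (asum A N) \oc x = cx c].
Proof.
have [N [U0 [w [u [WN UU0 [eta etaP]]]]]] := cX_minus c.
set S := swap_biproduct (asum A N).
have [C [b [q [[theta thetaP] iP qb]]]] := mapping_cone S (cx c) etaP.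
exists N, C, (bin1 S \oc w + bin2 S \oc cx c), b; split=> //; last 1 first.
- by rewrite compDr !compA /= bpr1in2 comp0l add0r bpr1in1 comp1m.
- apply: (cotV_perp (UV := UV)) => X d UX.
  have [rho rhoP] := c_conflation c.
  (* [M] is an extension of [X] by [U0], hence in U, so [- d2] lifts to [zeta] along the
     coreflection. Then [zeta] restricts to [eta] on [U0], and (ET4)^op exhibits [push q d] as the
     image of a class in E(X, R) with [R] isomorphic to [N], which is in V. *)
  have qd0 : push q d = 0.
    have [P [k1 [k2 dP]]] := realizes_ex d.
    have [M [s [e [h [d2 [_ _ seP d2E _]]]]]] := ET4 iP dP.
    have UM := cotU_extension (realizes_conflation seP) UU0 UX.
    have [zeta zetaE] := c_surj c UM (- d2).
    have [|z zE] := ext_exact_push (b := pull s zeta - eta) rhoP.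
      by rewrite pushD pushN push_pull zetaE pullN d2E opprK subrr.
    rewrite (cot_ext0 z UU0 (cV_V c)) push0 in zE.
    have {}zE : pull s zeta = eta by apply/eqP; rewrite -subr_eq0 zE.
    have [Q [l1 [l2 zetaP]]] := realizes_ex zeta.
    have [R [j1 [j2 [h' [d3 [_ _ RP <- _]]]]]] := ET4op zetaP seP.
    have VR : V R.
      rewrite zE in RP; have [f [fi _]] := (realizes_class _ _ etaP).1 RP.
      by apply: (cotV_iso WN.2); exists f.
    by rewrite (cot_ext0 d3 UX VR) push0.
  have [d' ->] := ext_exact_push iP qd0.
  have [d'' <-] := c_surj c UX d'.
  (* The composite of the conflation vanishes, so [A -> C] precomposed with [cx c] factors through
     [N], where E(X, N) = 0. *)
  have imE : b \oc bin2 S \oc cx c = - (b \oc bin1 S \oc w).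
    apply/eqP; rewrite -addr_eq0 addrC -!compA -compDr; apply/eqP.
    exact: (realizes_comp0 thetaP).
  rewrite -pushM imE pushNm pushM (cot_ext0 (push w d'') UX WN.2) push0.
  exact: oppr0.
- by exists theta.
Qed.

End Factorization.

(** * Morphisms with cone or cocone in the kernel *)

(** With [cocone_in] this is goodness when [P] is the kernel; [P] stays a parameter so that goodness
    passes from one kernel to a larger one. *)
Definition cone_in (B : extriangulated) (P : B -> Prop) (A C : B)
    (f : hom A C) :=
  exists N D (x : hom A (asum C N)) (y : hom (asum C N) D),
    [/\ P N, P D, conflation x y & bpr1 (asum C N) \oc x = f].

Definition cocone_in (B : extriangulated) (P : B -> Prop) (A C : B)
    (f : hom A C) :=
  exists N D (x : hom D (asum A N)) (y : hom (asum A N) C),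
    [/\ P N, P D, conflation x y & y \oc bin1 (asum A N) = f].

Lemma op_cone_in (B : extriangulated) (P : B -> Prop) (A C : B) (f : hom A C) :
  @cone_in (op_extriangulated B) P C A f <-> cocone_in P f.
Proof.
by split=> -[N [D [x [y [? ? xy fE]]]]]; exists N, D, y, x.
Qed.

Lemma cone_in_sub (B : extriangulated) (P Q : B -> Prop) (A C : B)
    (f : hom A C) :
  (forall X, P X -> Q X) -> cone_in P f -> cone_in Q f.
Proof.
move=> PQ [N [D [x [y [/PQ QN /PQ QD xy fE]]]]].
by exists N, D, x, y.
Qed.

Lemma cocone_in_sub (B : extriangulated) (P Q : B -> Prop) (A C : B)
    (f : hom A C) :
  (forall X, P X -> Q X) -> cocone_in P f -> cocone_in Q f.
Proof.
move=> PQ [N [D [x [y [/PQ QN /PQ QD xy fE]]]]].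
by exists N, D, x, y.
Qed.

Section SumHom.
Variable B : additive.
Variables (A A' C C' : B) (f : hom A C) (f' : hom A' C').

Lemma sum_hom_in1 : sum_hom f f' \oc bin1 (asum A A') = bin1 (asum C C') \oc f.
Proof.
by rewrite compDl -!compA bpr1in1 bpr2in1 compm1 !comp0r addr0.
Qed.

Lemma sum_hom_in2 : sum_hom f f' \oc bin2 (asum A A') = bin2 (asum C C') \oc f'.
Proof.
by rewrite compDl -!compA bpr2in2 bpr1in2 compm1 !comp0r add0r.
Qed.

Lemma sum_hom_pr1 : bpr1 (asum C C') \oc sum_hom f f' = f \oc bpr1 (asum A A').
Proof.
by rewrite compDr !compA bpr1in1 bpr1in2 comp1m !comp0l addr0.
Qed.

End SumHom.

Section ConeIn.
Variables (B : extriangulated) (UV : cotorsion_pair B).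
Implicit Types A C D M N X Y Z : B.
Local Notation U := (cotU UV).
Local Notation V := (cotV UV).
Local Notation W := (cotW UV).
Local Notation K := (kernel UV).

Lemma kernel_asum A C : K A -> K C -> K (asum A C).
Proof.
by apply: kernel_extension; apply: realizes_conflation (@ET2_split B A C).
Qed.

Lemma kernel0 : K (azero B).
Proof. exact/cotU_kernel/mem_sub0. Qed.

Lemma cone_in_inflation A M C (x : hom A M) (y : hom M C) :
  conflation x y -> K C -> cone_in K x.
Proof.
move=> [d dP] KC; set S := asum M (azero B).
exists (azero B), C, (bin1 S \oc x), (y \oc bpr1 S); split=> //.
- exact: kernel0.
- by exists d; apply: realizes_mid_iso (bpr1in1 S) (bin1_bpr1_azero S) dP.
- by rewrite compA bpr1in1 comp1m.
Qed.

(** Once [N1] is added to the second inflation the two compose, and by (ET4) the cone of the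
    composite is an extension of the two cones. *)
Lemma cone_in_comp A C D (g : hom C D) (f : hom A C) :
  cone_in K f -> cone_in K g -> cone_in K (g \oc f).
Proof.
move=> [N1 [C1 [x1 [y1 [KN1 KC1 [d1 d1P] <-]]]]].
move=> [N2 [C2 [x2 [y2 [KN2 KC2 [d2 d2P] <-]]]]].
have [F [e [e' [h [d [_ dP eP _ _]]]]]] := ET4 d1P (realizes_sum_idm N1 d2P).
have [k [[k' [k'k kk']] _ kp _]] := biproduct_iso
  (assoc_biproduct (asum (asum D N2) N1) (asum N2 N1)) (asum D (asum N2 N1)).
eexists (asum N2 N1), F, (k \oc (sum_hom x2 (idm N1) \oc x1)), (h \oc k').
split; [exact: kernel_asum| |by exists d; apply: realizes_mid_iso dP|].
  exact: kernel_extension (realizes_conflation eP) KC1 KC2.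
rewrite !compA kp /= -(compA (bpr1 (asum D N2))) sum_hom_pr1.
by rewrite !compA.
Qed.

Lemma coreflection_cone_in A (c : coreflection_seq UV A) : cone_in K (cx c).
Proof.
have [N [C [x [y [WN VC xy xE]]]]] := coreflection_cone c.
exists N, C, x, y; split=> //; first exact: cotU_kernel WN.1.
exact: cotV_kernel.
Qed.

Lemma reflection_cone_in A (r : reflection_seq UV A) : cone_in K (rz r).
Proof. exact: cone_in_inflation (r_conflation r) (cotU_kernel (rU_U r)). Qed.

(* [g] is an epimorphism after applying H, tested on a lift [g'] of [g] along
   a coreflection of its target. *)
Lemma cone_in_epi X Y V0 Y' (g : hom X Y) (v : hom V0 Y') (m : hom Y' Y)
    (g' : hom X Y') :
  cone_in K g -> conflation v m -> V V0 -> Bminus UV X -> Bminus UV Y' ->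
  factors W (m \oc g' - g) ->
  forall Z (h : hom Y' Z), Bplus UV Z -> factors W (h \oc g') -> factors W h.
Proof.
move=> [N [C [x [y [KN KC [th thP] xE]]]]] [mu muP] VV0 Xm Ym gW Z h Zp hW.
have [W0 [U0 [w [u [WW0 UU0 [eta etaP]]]]]] := Xm.
(* [g'] lifts [g] only modulo W. The error extends over [w] and lifts along [m], so a correction
   through [W0] makes [m \oc g1] equal to [g]. *)
have [e gE] : exists e : hom W0 Y', m \oc (g' - e \oc w) = g.
  have [X1 [WX1 [a [b abE]]]] := gW.
  have [a' a'E] := extend_along (a := a) etaP (cot_ext0 _ UU0 WX1.2).
  have [e eE] := lift_along (c := b \oc a') muP (cot_ext0 _ WW0.1 VV0).
  exists e; rewrite compBr compA -eE -compA -a'E -abE.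
  by rewrite opprB addrC subrK.
set g1 := g' - e \oc w in gE.
(* Likewise [h \oc g1], which vanishes modulo W, factors through [w]. *)
have [c cE] : exists c : hom W0 Z, h \oc g1 = c \oc w.
  have [X1 [WX1 [a [b abE]]]] := hW.
  have [a' a'E] := extend_along (a := a) etaP (cot_ext0 _ UU0 WX1.2).
  exists (b \oc a' - h \oc e).
  by rewrite compBr compBl abE a'E !compA.
clearbody g1; clear hW gW.
have [D [b [q [bP iP _]]]] := mapping_cone (asum (asum Y N) W0) w thP.
have KD : K D.
  exact: kernel_extension (realizes_conflation iP) (cotU_kernel WW0.1) KC.
have tP := realizes_sum_idm_defl W0 (realizes_sum_idm_defl N muP).
set t := sum_hom _ _ in tP.
(* The component [g] of the inflation [(x, w)] is replaced by its lift [g1]; [octahedral_lift] makes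
   [x1] an inflation with cone [C'] in K. *)
pose x1 := bin1 (asum (asum Y' N) W0) \oc
  (bin1 (asum Y' N) \oc g1 + bin2 (asum Y' N) \oc (bpr2 (asum Y N) \oc x)) +
  bin2 (asum (asum Y' N) W0) \oc w.
have tx1 : t \oc x1 = bin1 (asum (asum Y N) W0) \oc x +
    bin2 (asum (asum Y N) W0) \oc w.
  rewrite compDr !compA sum_hom_in1 sum_hom_in2 -!compA comp1m.
  congr (_ \oc _ + _).
  rewrite compDr !compA sum_hom_in1 sum_hom_in2 -!compA comp1m gE -xE.
  by rewrite !compA -compDl binpr comp1m.
rewrite -tx1 in bP.
have [C' [y' [v' [t' [[th' x1P] v'P]]]]] :=
  octahedral_lift (realizes_conflation tP) bP.
have KC' : K C' by apply: kernel_extension v'P (cotV_kernel VV0) KD.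
(* [phi] is [h] on [Y'], zero on [N] and [- c] on [W0], so it kills [x1] and factors through
   [C']. *)
pose phi := h \oc bpr1 (asum Y' N) \oc bpr1 (asum (asum Y' N) W0)
  - c \oc bpr2 (asum (asum Y' N) W0).
have [|psi psiE] := hom_exactl (g := phi) x1P.
  rewrite compBl /x1 !compDr -!compA.
  rewrite !(compA (bpr1 (asum (asum Y' N) W0))).
  rewrite !(compA (bpr2 (asum (asum Y' N) W0))).
  rewrite bpr1in1 bpr1in2 bpr2in1 bpr2in2 !comp0l !comp1m !comp0r addr0 add0r.
  rewrite !(compA (bpr1 (asum Y' N))) bpr1in1 bpr1in2 comp1m comp0l comp0r.
  by rewrite addr0 add0r cE subrr.
have -> : h = psi \oc (y' \oc bin1 (asum (asum Y' N) W0) \oc bin1 (asum Y' N)).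
  rewrite !compA -psiE !compBl -!compA !(compA (bpr1 (asum (asum Y' N) W0))).
  rewrite !(compA (bpr2 (asum (asum Y' N) W0))) bpr1in1 bpr2in1 comp0l comp0r.
  by rewrite subr0 comp1m bpr1in1 compm1.
exact: kernel_factors Ym Zp KC'.
Qed.

Definition epi_on_Bplus X Y (k : hom X Y) :=
  forall Z (h : hom Y Z), Bplus UV Z -> factors W (h \oc k) -> factors W h.

Definition mono_on_Bminus X Y (k : hom X Y) :=
  forall Z (h : hom Z X), Bminus UV Z -> factors W (k \oc h) -> factors W h.

(** [C] is the mapping cone of [k] along [X -> W0], an extension of [U0] by [Y]. The composite
    [X -> Y -> C] passes through [W0], so the epimorphism property makes [Y -> C -> C^+] vanish
    modulo W, and then [C -> C^+] as well. As classes in E(C, A) with [A] in V come from [C^+], they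
    are zero, which puts [C] in U. *)
Lemma epi_cone (p : forall A, reflection_seq UV A) X Y (k : hom X Y) :
  Bminus UV X -> epi_on_Bplus k ->
  exists N C (x : hom X (asum Y N)) (y : hom (asum Y N) C),
    [/\ W N, U C, conflation x y & bpr1 (asum Y N) \oc x = k].
Proof.
move=> [W0 [U0 [w [u [WW0 UU0 [eta etaP]]]]]] k_epi.
set S := swap_biproduct (asum Y W0).
have [C [b [q [[theta thP] iP qb]]]] := mapping_cone S k etaP.
exists W0, C, (bin1 S \oc w + bin2 S \oc k), b; split=> //; last 1 first.
- by rewrite compDr !compA /= bpr1in2 comp0l add0r bpr1in1 comp1m.
- have r := p C; have Zp := rZ_plus r.
  have : factors W (rz r \oc (b \oc bin2 S)).
    apply: k_epi => //.
    have -> : rz r \oc (b \oc bin2 S) \oc k = - (rz r \oc b \oc bin1 S \oc w).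
      apply/eqP; rewrite -addr_eq0 addrC -!compA -!compDr; apply/eqP.
      by rewrite (realizes_comp0 thP) comp0r.
    by apply: factorsN; apply: factors_through.
  move=> [X1 [WX1 [a [c acE]]]].
  have [a' a'E] := extend_along (a := a) iP (cot_ext0 _ UU0 WX1.2).
  have [|d dE] := hom_exactl (g := rz r - c \oc a') iP.
    by rewrite compBl acE a'E compA subrr.
  have [X2 [WX2 [a2 [c2 rE]]]] : factors W (rz r).
    rewrite -(subrK (c \oc a') (rz r)) dE; apply: factorsD.
      exact/factors_compr/(cotU_Bplus_factors (UV := UV)).
    exact: factors_through.
  apply: (cotU_perp (UV := UV)) => A e VA; have [e' <-] := r_surj r VA e.
  by rewrite rE pullM (cot_ext0 (pull c2 e') WX2.1 VA) pull0.
- by exists theta.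
Qed.

End ConeIn.

(** * Dual statements, read off in the opposite category *)

Section Duals.
Variables (B : extriangulated) (UV : cotorsion_pair B).
Implicit Types A C D M N X Y Z : B.
Local Notation Bop := (op_extriangulated B).
Local Notation UVop := (op_cotorsion UV).
Local Notation E := (E_ B).
Local Notation U := (cotU UV).
Local Notation V := (cotV UV).
Local Notation W := (cotW UV).
Local Notation K := (kernel UV).

Lemma op_cone_in_kernel X Y (f : hom X Y) :
  @cone_in Bop (kernel UVop) Y X f <-> cocone_in K f.
Proof.
split=> [fK|/op_cone_in fK].
  by apply/op_cone_in; apply: (@cone_in_sub Bop) fK => A /op_kernel.
by apply: (@cone_in_sub Bop) fK => A KA; apply/op_kernel.
Qed.

Lemma cocone_in_comp A C D (g : hom C D) (f : hom A C) :
  cocone_in K f -> cocone_in K g -> cocone_in K (g \oc f).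
Proof.
move=> /op_cone_in_kernel fK /op_cone_in_kernel gK; apply/op_cone_in_kernel.
exact: (@cone_in_comp Bop UVop D C A f g gK fK).
Qed.

Lemma reflection_cocone A (r : reflection_seq UV A) :
  exists N D (x : hom D (asum A N)) (y : hom (asum A N) (rZ r)),
    [/\ W N, U D, conflation x y & y \oc bin1 (asum A N) = rz r].
Proof.
have [N [D [x [y [[VN UN] UD xy E]]]]] := coreflection_cone (op_reflection r).
by exists N, D, y, x.
Qed.

Lemma reflection_cocone_in A (r : reflection_seq UV A) : cocone_in K (rz r).
Proof.
exact/op_cone_in_kernel/(@coreflection_cone_in Bop UVop A (op_reflection r)).
Qed.

Lemma coreflection_cocone_in A (c : coreflection_seq UV A) :
  cocone_in K (cx c).
Proof.
exact/op_cone_in_kernel/(@reflection_cone_in Bop UVop A (op_coreflection c)).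
Qed.

Lemma cocone_in_mono X Y U0 X' (g : hom X Y) (z : hom X X') (u : hom X' U0)
    (g' : hom X' Y) :
  cocone_in K g -> conflation z u -> U U0 -> Bplus UV Y -> Bplus UV X' ->
  factors W (g' \oc z - g) -> mono_on_Bminus UV g'.
Proof.
move=> /op_cone_in_kernel gK zu UU0 /op_Bminus Yp /op_Bminus Xp.
move=> /op_factors gW Z h /op_Bplus Zm /op_factors hW; apply/op_factors.
exact: (@cone_in_epi Bop UVop Y X U0 X' g u z g' gK zu UU0 Yp Xp gW Z h Zm hW).
Qed.

Lemma mono_cocone (m : forall A, coreflection_seq UV A) X Y (k : hom X Y) :
  Bplus UV Y -> mono_on_Bminus UV k ->
  exists N D (x : hom D (asum X N)) (y : hom (asum X N) Y),
    [/\ W N, V D, conflation x y & y \oc bin1 (asum X N) = k].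
Proof.
move=> /op_Bminus Yp k_mono.
have [|N [D [x [y [[VN UN] VD xy kE]]]]] := @epi_cone Bop UVop
  (fun A => op_coreflection (m A)) Y X k Yp; last by exists N, D, y, x.
by move=> Z h /op_Bplus Zm /op_factors hW; apply/op_factors/k_mono.
Qed.

Lemma reflection_minus A (r : reflection_seq UV A) :
  Bminus UV A -> Bminus UV (rZ r).
Proof.
move=> /op_Bplus Am; apply/op_Bplus.
exact: (@coreflection_plus Bop UVop A (op_reflection r) Am).
Qed.

End Duals.

(** * Invertibility modulo W of transposes of good morphisms *)

Section Hearts.
Variables (B : extriangulated) (UV : cotorsion_pair B).
Implicit Types A C D M N X Y Z : B.
Local Notation W := (cotW UV).
Local Notation K := (kernel UV).
Local Notation "[ 'mod' f ]" :=
  (qpi (cotW UV) f : hom (p := BmodW UV) _ _) (at level 0).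

Lemma mod_comp A C D (g : hom C D) (f : hom A C) :
  [mod g] \oc [mod f] = [mod g \oc f].
Proof. exact: qpi_comp. Qed.

Lemma modP A C (f g : hom A C) : [mod f] = [mod g] <-> factors W (f - g).
Proof.
by split=> [/qpiP/idealP|fg]; last apply/qpiP/idealP.
Qed.

Lemma mod0P A C (f : hom A C) : [mod f] = 0 <-> factors W f.
Proof.
have mod0 : [mod (0 : hom A C)] = 0.
  by apply: (@addrI _ [mod (0 : hom A C)]); rewrite -qpiD !addr0.
by rewrite -mod0 modP subr0.
Qed.

Section Choices.
Variables (p : forall A, reflection_seq UV A).
Variables (m : forall A, coreflection_seq UV A).

(* The cone C of k lies in U and its cocone D in V; as E(C, D) = 0 both
   conflations split up to W. *)
Lemma epi_mono_iso X Y (k : hom X Y) :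
  Bminus UV X -> Bplus UV Y -> epi_on_Bplus UV k -> mono_on_Bminus UV k ->
  is_iso [mod k].
Proof.
move=> Xm Yp k_epi k_mono.
have [N [C [x [y [WN UC [th thP] xE]]]]] := epi_cone p Xm k_epi.
have [N' [D [x' [y' [WN' VD [ep epP] yE]]]]] := mono_cocone m Yp k_mono.
have ep0 : ep = 0.
  (* [k] factors through [y'], so its pullback of [ep] vanishes; hence the pullback of [ep] to
     [Y + N] comes from E(C, D) = 0. *)
  have [|c cE] := ext_exact_pull (b := pull (bpr1 (asum Y N)) ep) thP.
    by rewrite -pullM xE -yE pullM (pull_defl0 epP) pull0.
  rewrite (cot_ext0 c UC VD) pull0 in cE.
  by rewrite -(pull1 ep) -(bpr1in1 (asum Y N)) pullM cE pull0.
have th0 : th = 0.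
  have [|c cE] := ext_exact_push (b := push (bin1 (asum X N')) th) epP.
    by rewrite -pushM yE -xE pushM (push_infl0 thP) push0.
  rewrite (cot_ext0 c UC VD) push0 in cE.
  by rewrite -(push1 th) -(bpr1in1 (asum X N')) pushM cE push0.
have [|s sE] := lift_along (c := idm Y) epP; first by rewrite pull1.
have [|r rE] := extend_along (a := idm X) thP; first by rewrite push1.
(* Dropping the [N] and [N'] components of the splittings [r] and [s] costs only maps through W. *)
apply: (is_iso_linv_rinv (l := [mod r \oc bin1 (asum Y N)])
                         (r := [mod bpr1 (asum X N') \oc s])).
- rewrite mod_comp; apply/modP; rewrite [idm X]rE -xE -[in r \oc x](comp1m x).
  rewrite -(binpr (asum Y N)) compDl compDr !compA opprD addrA subrr add0r.
  by apply: factorsN; rewrite -!compA compA; apply: factors_through.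
- rewrite mod_comp; apply/modP; rewrite [idm Y]sE -yE -[in y' \oc s](comp1m s).
  rewrite -(binpr (asum X N')) compDl compDr !compA opprD addrA subrr add0r.
  by apply: factorsN; rewrite -!compA compA; apply: factors_through.
Qed.

(** [k] is the transpose of [g]. Precomposed with the reflection it lifts [g], which makes [k] epi;
    postcomposed with the coreflection it extends [g], which makes [k] mono. *)
Lemma cone_cocone_in_iso X Y (r : reflection_seq UV X)
    (c : coreflection_seq UV Y) (g : hom X Y)
    (k : hom (p := BmodW UV) (rZ r) (cX c)) :
  Bminus UV X -> Bplus UV Y -> cone_in K g -> cocone_in K g ->
  [mod cx c] \oc k \oc [mod rz r] = [mod g] -> is_iso k.
Proof.
move=> Xm Yp g1 g2; have [k' ->] := qpi_surj k; rewrite !mod_comp => /modP gW.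
have rp := rZ_plus r; have rm := reflection_minus r Xm.
have cm := cX_minus c; have cp := coreflection_plus c Yp.
apply: epi_mono_iso => //.
  move=> Z h Zp hW.
  apply: (cone_in_epi (g' := k' \oc rz r) g1 (c_conflation c) (cV_V c)) Zp _
    => //.
    by rewrite compA.
  by rewrite compA; apply: factors_compr.
move=> Z h Zm hW.
apply: (cocone_in_mono (g' := cx c \oc k') g2 (r_conflation r) (rU_U r)) Zm _
  => //.
by rewrite -compA; apply: factors_compl.
Qed.

End Choices.
End Hearts.

(** * The associated functor *)

Section AssociatedFunctor.
Variables (B : extriangulated) (UV : cotorsion_pair B).
Variables (p : reflection_choice UV) (m : coreflection_choice UV).
Implicit Types A C D M N X Y Z : B.
Local Notation V := (cotV UV).
Local Notation K := (kernel UV).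
Local Notation H := (assoc_functor p m).
Local Notation "[ 'mod' f ]" :=
  (qpi (cotW UV) f : hom (p := BmodW UV) _ _) (at level 0).

Local Notation assoc_map f :=
  (sigma_minus_map m (sigma_plus_map p [mod f])).

Lemma refl_iso A : Bplus UV A -> is_iso [mod rz (p A)].
Proof.
move=> Ap.
(* The object [rZ (p A)] varies along [refl_id], so the property is phrased on dependent pairs
   before rewriting. *)
pose P (s : {Z : B & hom A Z : Type}) := is_iso [mod projT2 s].
rewrite -/(P (existT (fun Z => hom A Z : Type) _ (rz (p A)))) refl_id //.
exact: (@is_iso_idm (BmodW UV) A).
Qed.

Lemma corefl_iso A : Bminus UV A -> is_iso [mod cx (m A)].
Proof.
move=> Am.
pose P (s : {X : B & hom X A : Type}) := is_iso [mod projT2 s].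
rewrite -/(P (existT (fun X => hom X A : Type) _ (cx (m A)))) corefl_id //.
exact: (@is_iso_idm (BmodW UV) A).
Qed.

Lemma coreflection_lift X Y (c : coreflection_seq UV Y)
    (s : hom (p := BmodW UV) X Y) :
  Bminus UV X ->
  exists t : hom (p := BmodW UV) X (cX c), [mod cx c] \oc t = s.
Proof.
move=> /corefl_iso[i [_ mi]]; have [t tE] := coreflection_ex (m X) c s.
by exists (t \oc i); rewrite compA tE -compA mi compm1.
Qed.

(** This compares [(A^-)^+] with [(A^+)^-]: [k] is the transpose of [A^- -> A -> A^+], a composite
    of good morphisms. *)
Lemma comparison_iso A :
  exists k : hom (p := BmodW UV) (rZ (p (cX (m A)))) (cX (m (rZ (p A)))),
    is_iso k /\ [mod cx (m (rZ (p A)))] \oc k \oc [mod rz (p (cX (m A)))] =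
      [mod rz (p A)] \oc [mod cx (m A)].
Proof.
have rm := reflection_minus (p (cX (m A))) (cX_minus (m A)).
have [k kE] := coreflection_lift (m (rZ (p A)))
  (sigma_plus_map p [mod cx (m A)]) rm.
exists k; have kE' : [mod cx (m (rZ (p A)))] \oc k \oc
    [mod rz (p (cX (m A)))] = [mod rz (p A)] \oc [mod cx (m A)].
  by rewrite kE sigma_plus_mapP.
split=> //; move: kE'; rewrite mod_comp.
apply: (cone_cocone_in_iso p m (cX_minus _) (rZ_plus _)).
  exact: cone_in_comp (coreflection_cone_in _) (reflection_cone_in _).
exact: cocone_in_comp (coreflection_cocone_in _) (reflection_cocone_in _).
Qed.

(** Composed with the comparison isomorphism, [fmap H f] is the transpose of the good composite
    [A^- -> A -> C -> C^+]. *)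
Lemma assoc_functor_iso A C (f : hom A C) :
  cone_in K f -> cocone_in K f -> is_iso (fmap H f).
Proof.
move=> f1 f2; have [k [k_iso kE]] := comparison_iso A.
have [g [gk kg]] : is_iso ((assoc_map f) \oc k).
  apply: (cone_cocone_in_iso p m (g := rz (p C) \oc (f \oc cx (m A)))
            (cX_minus _) (rZ_plus _)).
  - apply: cone_in_comp (reflection_cone_in _).
    exact: cone_in_comp (coreflection_cone_in _) f1.
  - apply: cocone_in_comp (reflection_cocone_in _).
    exact: cocone_in_comp (coreflection_cocone_in _) f2.
  - have fkE : sigma_plus_map p [mod f] \oc ([mod cx (m (rZ (p A)))] \oc k
        \oc [mod rz (p (cX (m A)))]) =
      sigma_plus_map p [mod f] \oc ([mod rz (p A)] \oc [mod cx (m A)]).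
      by rewrite kE.
    rewrite !compA sigma_plus_mapP in fkE.
    by rewrite compA sigma_minus_mapP -!mod_comp compA.
have fE : is_iso (assoc_map f) by apply: is_iso_cancelr k_iso; exists g.
by have [h hE] := fE; exists h.
Qed.

(** If H(A) = 0, the identity of [(A^+)^-] factors through W, so E(U, A^+) = 0 by the coreflection
    property and [A^+] is in V; the cocone of the reflection then puts [A + N] in [U * V].
    Conversely [A^+] is an extension of an object of U by [A], so it lies in K, and the coreflection
    [(A^+)^- -> A^+] vanishes modulo W. *)
Lemma assoc_functor_zero A : zero_object (H A) <-> K A.
Proof.
split=> [/zero_objectP HA0|KA].
  have /mod0P[X [WX [a [b abE]]]] : [mod idm (cX (m (rZ (p A))))] = 0.
    exact: HA0.
  have VA : V (rZ (p A)).
    apply: (cotV_perp (UV := UV)) => Y d UY.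
    have [d' <-] := c_surj (m (rZ (p A))) UY d.
    rewrite -[d']push1 abE pushM (cot_ext0 (push a d') UY WX.2).
    by rewrite !push0.
  have [N [D [x [y [WN UD xy _]]]]] := reflection_cocone (p A).
  by apply/kernelP; exists N, D, (rZ (p A)), x, y.
have KAp : K (rZ (p A)).
  exact: kernel_extension (r_conflation _) KA (cotU_kernel (rU_U _)).
apply/zero_objectP/(coreflection_uniq (r' := m (rZ (p A)))).
rewrite compm1 comp0r; apply/mod0P; rewrite -[cx _]comp1m.
exact: kernel_factors (cX_minus _) (rZ_plus _) KAp.
Qed.

(** Uniqueness for reflections and coreflections makes the construction additive, so the two images
    differ by a composite through the zero object [H M]. *)
Lemma assoc_functor_eq A C M (f g : hom A C) (a : hom A M) (b : hom M C) :
  K M -> f - g = b \oc a -> fmap H f = fmap H g.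
Proof.
move=> KM fgE.
have /zero_objectP HM0 := (assoc_functor_zero M).2 KM.
have Hba : assoc_map b \oc assoc_map a = 0.
  rewrite -(compm1 (assoc_map b)).
  have -> : idm (cX (m (rZ (p M))) : BmodW UV) = 0 by exact: HM0.
  by rewrite comp0r comp0l.
have sE : sigma_plus_map p [mod f] - sigma_plus_map p [mod g] =
    sigma_plus_map p [mod b] \oc sigma_plus_map p [mod a].
  apply: (reflection_uniq (r := p A)).
  rewrite compBl !sigma_plus_mapP -compBr -compA sigma_plus_mapP compA.
  rewrite sigma_plus_mapP -compA; congr (_ \oc _).
  have -> : f = b \oc a + g by rewrite -fgE subrK.
  by rewrite qpiD addrK mod_comp.
apply/eqP; rewrite -subr_eq0; apply/eqP.
apply: (coreflection_uniq (r' := m (rZ (p C)))).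
rewrite -[in RHS]Hba compA sigma_minus_mapP -compA sigma_minus_mapP compA -sE.
by rewrite compBl compBr !sigma_minus_mapP.
Qed.

End AssociatedFunctor.

(** * Heart equivalences *)

Section Zigzag.
Variables (C D : preadditive) (F G : functor C D) (M : C -> D).
Variables (Mmap : forall A A', hom A A' -> hom (M A) (M A')).
Variables (t : forall A, hom (F A) (M A)) (s : forall A, hom (G A) (M A)).

Lemma zigzag_nat_iso :
  (forall A, is_iso (t A)) -> (forall A, is_iso (s A)) ->
  (forall A A' (f : hom A A'), t A' \oc fmap F f = Mmap f \oc t A) ->
  (forall A A' (f : hom A A'), s A' \oc fmap G f = Mmap f \oc s A) ->
  nat_iso F G.
Proof.
move=> t_iso s_iso tE sE; pose i A := sval (cid (s_iso A)).
have iP A : i A \oc s A = idm _ /\ s A \oc i A = idm _.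
  exact: svalP (cid (s_iso A)).
exists (fun A => i A \oc t A); split=> [A|A A' f].
  by apply: is_iso_comp => //; exists (s A); have [] := iP A.
have inat : i A' \oc Mmap f = fmap G f \oc i A.
  rewrite -[Mmap f]compm1 -(iP A).2 (compA (Mmap f)) -sE -!compA.
  by rewrite (compA (i A')) (iP A').1 comp1m.
by rewrite -compA tE !compA inat.
Qed.

End Zigzag.

(** * Functors on an ideal quotient *)

Section QuotientLift.
Variables (B : additive) (W : additive_sub B) (D : preadditive).
Variables (F : functor B D).
Hypothesis FW : forall (A C : B) (f g : hom A C),
  factors W (f - g) -> fmap F f = fmap F g.

Definition quot_lift_map (A C : quot_cat W) (q : hom A C) :
  hom (F A) (F C) := fmap F (repr q).

Lemma quot_lift_mapE (A C : B) (f : hom A C) :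
  quot_lift_map (qpi W f) = fmap F f.
Proof. by apply/FW/idealP/qpiP; rewrite /qpi reprK. Qed.

Lemma quot_lift_map1 (A : quot_cat W) : quot_lift_map (idm A) = idm (F A).
Proof. by rewrite /= quot_lift_mapE fmap1. Qed.

Lemma quot_lift_mapM (A C X : quot_cat W) (g : hom C X) (f : hom A C) :
  quot_lift_map (g \oc f) = quot_lift_map g \oc quot_lift_map f.
Proof.
have [g' ->] := qpi_surj g; have [f' ->] := qpi_surj f.
by rewrite /= qpi_comp !quot_lift_mapE fmapM.
Qed.

Definition quot_lift : functor (quot_cat W) D :=
  @Functor (quot_cat W) D F quot_lift_map quot_lift_map1 quot_lift_mapM.

End QuotientLift.

(** * Zero objects under isomorphisms and equivalences *)

Lemma zero_object_iso (C : preadditive) (A Z : C) :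
  isomorphic A Z -> zero_object Z -> zero_object A.
Proof.
move=> [f [g [gf fg]]] /zero_objectP Z0; apply/zero_objectP.
by rewrite -gf -(comp1m f) Z0 comp0l comp0r.
Qed.

(** Functors here need not be additive. The inverse [G] sends the identity and the zero endomorphism
    of [F Z] to the same map, since [G (F Z)] is isomorphic to [Z]; naturality of the counit [b]
    then identifies the two. *)
Lemma equivalence_zero_object (C D : preadditive) (F : functor C D) (Z : C) :
  is_equivalence F -> zero_object Z -> zero_object (F Z).
Proof.
move=> [G [[a [a_iso _]] [b [b_iso b_nat]]]] Z0; apply/zero_objectP.
have FZ0 : zero_object (G (F Z)).
  by apply: zero_object_iso Z0; exists (a Z); apply: a_iso.
have [_ [[h [_ hU]] _]] := (conj I (FZ0 (G (F Z)))).
have E0 : fmap G (idm (F Z)) = fmap G 0.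
  exact: etrans (esym (hU _ I)) (hU _ I).
have [i [_ bi]] := b_iso (F Z).
have := b_nat _ _ (idm (F Z)); have := b_nat _ _ (0 : hom (F Z) (F Z)).
rewrite /= E0 => -> /(congr1 (fun z => z \oc i)).
by rewrite -!compA bi !compm1.
Qed.

(** * Vanishing of the associated functor *)

Section Vanishing.
Variables (B : extriangulated) (UV : cotorsion_pair B).
Variables (p : reflection_choice UV) (m : coreflection_choice UV).
Local Notation H := (assoc_functor p m).

Lemma vanishes_on_kernel (X : B -> Prop) :
  vanishes_on H X <-> forall A, X A -> kernel UV A.
Proof.
split=> [HX A /HX[Z Z0 AZ]|XK A /XK KA].
  by apply/(assoc_functor_zero p m); apply: zero_object_iso Z0.
exists (H A); first exact/assoc_functor_zero.
by exists (idm _); apply: is_iso_idm.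
Qed.

(** [H A] is a retract of [H X], which is zero. *)
Lemma kernel_summand (A X : B) : summand A X -> kernel UV X -> kernel UV A.
Proof.
move=> [A' [S [f [g [gf _]]]]] /(assoc_functor_zero p m)/zero_objectP HX0.
apply/(assoc_functor_zero p m)/zero_objectP.
have rs : bpr1 S \oc g \oc (f \oc bin1 S) = idm A.
  by rewrite -compA (compA g) gf comp1m bpr1in1.
rewrite -fmap1 -rs fmapM -[fmap _ (f \oc _)]comp1m HX0 comp0l.
exact: comp0r.
Qed.

Lemma kernel_min (UV' : cotorsion_pair B) :
  (forall A, cotU UV' A -> kernel UV A) ->
  (forall A, cotV UV' A -> kernel UV A) ->
  forall A, kernel UV' A -> kernel UV A.
Proof.
move=> UK VK A [M [X [Y [x [y [/UK KX /VK KY xy]]]]] AM].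
exact: kernel_summand AM (kernel_extension xy KX KY).
Qed.

End Vanishing.

(** * The functor induced between the hearts *)

Section Transfer.
Variables (B : extriangulated) (UV UV' : cotorsion_pair B).
Variables (p : reflection_choice UV) (m : coreflection_choice UV).
Variables (p' : reflection_choice UV') (m' : coreflection_choice UV').
Hypothesis kernel_le : forall A, kernel UV A -> kernel UV' A.
Local Notation H := (assoc_functor p m).
Local Notation H' := (assoc_functor p' m').
Local Notation "[ 'mod' f ]" :=
  (qpi (cotW UV) f : hom (p := BmodW UV) _ _) (at level 0).

Lemma assoc_functor_factors_eq (A C : B) (f g : hom A C) :
  factors (cotW UV) (f - g) -> fmap H' f = fmap H' g.
Proof.
move=> [X [WX [a [b]]]]; apply: assoc_functor_eq.
exact/kernel_le/cotU_kernel/(WX.1).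
Qed.

(** [H'] descends to the quotient because W is contained in K, hence in the kernel of [UV']. *)
Definition transfer_quot : functor (BmodW UV) (heart UV') :=
  quot_lift assoc_functor_factors_eq.

Definition transfer : functor (heart UV) (heart UV') :=
  functor_comp transfer_quot (@full_incl (BmodW UV) (@inH B UV)).

(** [H'] inverts both legs of [(A^+)^- -> A^+ <- A], which are good for K and so for the larger
    kernel. *)
Lemma transfer_assoc_functor : nat_iso (functor_comp transfer H) H'.
Proof.
apply: (@zigzag_nat_iso _ _ (functor_comp transfer H) H'
  (fun A => H' (rZ (p A)))
  (fun A C f => fmap transfer_quot (sigma_plus_map p [mod f]))
  (fun A => fmap H' (cx (m (rZ (p A)))))
  (fun A => fmap H' (rz (p A)))).
- move=> A; apply: assoc_functor_iso.
    exact: cone_in_sub kernel_le (coreflection_cone_in _).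
  exact: cocone_in_sub kernel_le (coreflection_cocone_in _).
- move=> A; apply: assoc_functor_iso.
    exact: cone_in_sub kernel_le (reflection_cone_in _).
  exact: cocone_in_sub kernel_le (reflection_cocone_in _).
- move=> A C f.
  rewrite -!(quot_lift_mapE assoc_functor_factors_eq).
  rewrite -[LHS](fmapM transfer_quot) -[RHS](fmapM transfer_quot).
  congr (fmap transfer_quot _); exact: sigma_minus_mapP.
- move=> A C f.
  rewrite -!(quot_lift_mapE assoc_functor_factors_eq).
  rewrite -[LHS](fmapM transfer_quot) -[RHS](fmapM transfer_quot).
  congr (fmap transfer_quot _); exact/esym/sigma_plus_mapP.
Qed.

End Transfer.

(** * Mutually inverse transfers and the three equivalent conditions *)

Section HeartEquivalence.
Variables (B : extriangulated).

(** The round trip applies [H] to [H' A], which [transfer_assoc_functor] identifies with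
    [H A = (A^+)^-]. For [A] in the heart both [(A^+)^- -> A^+] and [A -> A^+] are invertible modulo
    W, and the zigzag runs through [A^+]. *)
Lemma transfer_inverse (UV UV' : cotorsion_pair B)
    (p : reflection_choice UV) (m : coreflection_choice UV)
    (p' : reflection_choice UV') (m' : coreflection_choice UV')
    (K1 : forall A, kernel UV A -> kernel UV' A)
    (K2 : forall A, kernel UV' A -> kernel UV A) :
  nat_iso (functor_comp (transfer p m K2) (transfer p' m' K1))
    (functor_id (heart UV)).
Proof.
pose H := assoc_functor p m.
have [a [a_iso a_nat]] := transfer_assoc_functor p' m' p m K2.
have inH_refl (A : heart UV) : inH UV (rZ (p (sval A))).
  by split; [apply: rZ_plus | apply: reflection_minus (svalP A).2].
pose M (A : heart UV) : heart UV := exist _ _ (inH_refl A).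
pose F := functor_comp (transfer p m K2) (transfer p' m' K1).
pose t (A : heart UV) : hom (F A) (M A) :=
  comp (p := heart UV) (B := H (sval A)) (C := M A)
    (qpi _ (cx (m (rZ (p (sval A)))))) (a (sval A)).
pose s (A : heart UV) : hom A (M A) := qpi _ (rz (p (sval A))).
apply: (@zigzag_nat_iso _ _ F (functor_id _) M
  (fun A C q => sigma_plus_map p q) t s).
- move=> A; apply: is_iso_comp; last by apply: a_iso.
  apply: (corefl_iso m); exact: (inH_refl A).2.
- by move=> A; apply: refl_iso (svalP A).1.
- move=> A C q; have [f ->] := qpi_surj q.
  have FE : fmap F (qpi (cotW UV) f : hom A C) =
      fmap (functor_comp (transfer p m K2) (assoc_functor p' m')) f.
    have TE : fmap (transfer p' m' K1) (qpi (cotW UV) f : hom A C) =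
      fmap (assoc_functor p' m') f.
      exact: (quot_lift_mapE (assoc_functor_factors_eq p' m' K1) f).
    exact: (congr1 (fun z : hom (transfer p' m' K1 A) (transfer p' m' K1 C) =>
      fmap (transfer p m K2) z) TE).
  rewrite FE -[LHS]compA a_nat [LHS]compA [RHS]compA.
  by congr (_ \oc _); apply: sigma_minus_mapP.
- by move=> A C q; apply/esym/sigma_plus_mapP.
Qed.

End HeartEquivalence.

Theorem proposition3p12 (B : extriangulated) (UV UV' : cotorsion_pair B)
    (p : reflection_choice UV) (m : coreflection_choice UV)
    (p' : reflection_choice UV') (m' : coreflection_choice UV') :
  let H := assoc_functor p m in
  let H' := assoc_functor p' m' in
  (heart_equivalent H H' <->
     (vanishes_on H' (cotU UV) /\ vanishes_on H' (cotV UV)) /\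
     (vanishes_on H (cotU UV') /\ vanishes_on H (cotV UV'))) /\
  ((vanishes_on H' (cotU UV) /\ vanishes_on H' (cotV UV)) /\
     (vanishes_on H (cotU UV') /\ vanishes_on H (cotV UV')) <->
   (forall A : B, kernel UV A <-> kernel UV' A)).
Proof.
move=> H H'; rewrite !vanishes_on_kernel.
set vanish := (X in (_ <-> X) /\ _).
have vanishK : vanish <-> forall A : B, kernel UV A <-> kernel UV' A.
  split=> [[[UK VK] [U'K V'K]] A|KK].
    by split; [apply: (kernel_min p' m') | apply: (kernel_min p m)].
  by split; split=> A; [move/cotU_kernel/KK | move/cotV_kernel/KK
    | move/cotU_kernel/KK | move/cotV_kernel/KK].
split=> //; split=> [[F [F_eq [a [a_iso _]]]]|/vanishK KK].
(* An equivalence preserves and reflects zero objects, so [H] and [H'] vanish on the same objects,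
   which form the kernels. *)
- have zeroHH' A : zero_object (H A) <-> zero_object (H' A).
    split=> HA0.
      apply: (zero_object_iso (Z := F (H A))); last first.
        exact: equivalence_zero_object F_eq HA0.
      by apply: isomorphic_sym; exists (a A); apply: a_iso.
    have FA0 : zero_object (F (H A)).
      by apply: zero_object_iso HA0; exists (a A); apply: a_iso.
    have [G [GF FG]] := F_eq.
    have G_eq : is_equivalence G by exists F.
    have [b [b_iso _]] := GF.
    apply: zero_object_iso (equivalence_zero_object G_eq FA0).
    by apply: isomorphic_sym; exists (b (H A)); apply: b_iso.
  apply/vanishK => A.
  rewrite -(assoc_functor_zero p m) -(assoc_functor_zero p' m').
  exact: zeroHH'.
- have K1 A := (KK A).1; have K2 A := (KK A).2.
  (* The quasi-inverse is the transfer in the other direction; both natural isomorphisms are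
     instances of one lemma with the pairs exchanged. *)
  exists (transfer p' m' K1); split; last exact: transfer_assoc_functor.
  exists (transfer p m K2); split; exact: transfer_inverse.
Qed.
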